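(* There is a distributed algorithm in the LOCAL model for the minimum directed 2-spanner problem that always outputs a directed 2-spanner of size at most $O(\log\frac{m}{n})$ times the minimum, and terminates within $O(\log n\log\Delta)$ rounds with high probability, where $n$, $m$, $\Delta$ are the number of vertices, number of edges, and maximum degree of the input graph.
   Context: For a directed graph $G=(V,E)$, a subgraph $H\subseteq E$ is a directed 2-spanner if for every edge $(u,v)\in E$, $H$ contains a directed path with at most 2 edges from $u$ to $v$; the minimum directed 2-spanner problem asks for one with the fewest edges. Distributed setting: the input graph is the communication network (communication is bidirectional on each edge); vertices have unique IDs and initially know their incident edges and directions; synchronous rounds; each vertex outputs a subset of its incident edges and the union is the spanner. In the LOCAL model messages have unbounded size. ''With high probability'' means with probability at least $1-1/n^c$ for a constant $c\geq1$. *)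

(* Defs.v *)
From HB Require Import structures.
From mathcomp Require Import all_boot all_order all_algebra.
From mathcomp Require Import reals exp.

Set Implicit Arguments.
Unset Strict Implicit.
Unset Printing Implicit Defensive.

Import Order.TTheory GRing.Theory Num.Theory.

(* The input graph, which is also the communication network: a loopless
   directed graph (antiparallel edges are allowed) that is connected once
   directions are ignored, with arbitrary distinct IDs.  IDs are not assumed
   to be bounded in terms of the number of vertices. *)
Record network := Network {
  vertex : finType;
  edges : {set vertex * vertex};
  vid : vertex -> nat;
  edges_loopless : forall v, (v, v) \notin edges;
  edges_connected : forall u v,
    connect [rel x y | ((x, y) \in edges) || ((y, x) \in edges)] u v;
  vid_inj : injective vid
}.

Section Graph.
Variable G : network.
Implicit Types (u v w : vertex G) (H : {set vertex G * vertex G}).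

Definition nb_vertices : nat := #|vertex G|.
Definition nb_edges : nat := #|edges G|.

Definition link u v : bool := ((u, v) \in edges G) || ((v, u) \in edges G).

Definition incident v : {set vertex G * vertex G} :=
  [set e in edges G | (e.1 == v) || (e.2 == v)].

Definition max_degree : nat := \max_(v : vertex G) #|incident v|.

Definition directed_2spanner H : Prop :=
  H \subset edges G /\
  forall u v, (u, v) \in edges G ->
    exists p : seq (vertex G),
      [/\ path [rel x y | (x, y) \in H] u p, last u p = v & size p <= 2].

Definition minimum_directed_2spanner H : Prop :=
  directed_2spanner H /\
  forall H', directed_2spanner H' -> #|H| <= #|H'|.

End Graph.

(* A randomized algorithm in the LOCAL model: the program run by every vertex.
   It has access to IDs only, and is given neither n nor Delta.
   - [init i out inn]: initial state of the vertex with ID [i] whose out- and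
     in-neighbours have the IDs listed (in increasing order) in [out], [inn].
   - In each round a vertex in state [s] draws a private uniform
     [r < (coins s).+1], sends [send s r j] to its neighbour with ID [j], and
     moves to state [recv s r inbox], where [inbox j] is the message sent by the
     neighbour with ID [j].
   - [output s = Some D] means that a vertex in state [s] has terminated; an
     incident edge (u, v) is in its output iff [D] holds at the pair of IDs of
     u and v (the values of [D] elsewhere are ignored). *)
Record local_algorithm := LocalAlgorithm {
  state : Type;
  message : Type;
  init : nat -> seq nat -> seq nat -> state;
  coins : state -> nat;
  send : state -> nat -> nat -> message;
  recv : state -> nat -> (nat -> option message) -> state;
  output : state -> option (pred (nat * nat))
}.

Section Execution.
Variables (A : local_algorithm) (G : network).

Definition config := vertex G -> state A.

Definition init_config : config := fun v =>
  init A (vid v)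
    (sort leq [seq vid w | w in [set w | (v, w) \in edges G]])
    (sort leq [seq vid w | w in [set w | (w, v) \in edges G]]).

Definition halted (c : config) (v : vertex G) : bool := isSome (output (c v)).
Definition all_halted (c : config) : bool := [forall v, halted c v].

(* Joint outcomes of the independent draws of all vertices in one round. *)
Definition draws (c : config) :=
  {dffun forall v : vertex G, 'I_(coins (c v)).+1}.

Definition inbox (c : config) (r : draws c) (v : vertex G) (j : nat) :
    option (message A) :=
  if [pick w | [&& link v w, vid w == j & ~~ halted c w]] is Some w
  then Some (send (c w) (r w) (vid v)) else None.

(* A terminated vertex keeps its state (hence its output) and sends nothing. *)
Definition step (c : config) (r : draws c) : config := fun v =>
  if halted c v then c v else recv (c v) (r v) (inbox r v).

(* [run t] is the configuration after [t] rounds, for some outcome of all the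
   draws. *)
Definition is_run (run : nat -> config) : Prop :=
  run 0 = init_config /\
  forall t, exists r : draws (run t), run t.+1 = step r.

Definition output_edges (c : config) : {set vertex G * vertex G} :=
  \bigcup_(v : vertex G)
    [set e in incident v |
      if output (c v) is Some D then D (vid e.1, vid e.2) else false].

(* Probability that the configuration reached from [c] in [t] rounds satisfies
   [Q]; in each round [draws c] carries the uniform distribution, i.e. the
   product of the uniform distributions of the individual draws. *)
Fixpoint prob_after (R : realType) (Q : pred config) (t : nat) (c : config) : R :=
  if t is t'.+1 then
    ((\sum_(r : draws c) prob_after R Q t' (step r)) / #|{: draws c}|%:R)%R
  else (Q c)%:R%R.

Definition prob_terminates (R : realType) (t : nat) : R :=
  prob_after R all_halted t init_config.

End Execution.

(* Main.v *)
(* The algorithm is a local greedy set cover.  The star candidates at a vertex v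
   at density level 2^k are represented by one set of edges at v, the core: the
   largest set each of whose edges lies in at least 2^k two-edge paths of the
   set through v that span a still uncovered edge.  The core shrinks when edges
   get covered, and it is nonempty as soon as v has a star of density 2^k.  In a
   phase, the vertices whose level is maximal among the vertices with which they
   share an uncovered edge draw a random rank; every uncovered edge votes for
   the best ranked of those whose core spans it; a vertex with at least one
   eighth of the possible votes adds its core.  An edge spanned only by
   vertices with empty cores adds itself.
   - Ratio: the cost of a chosen star is charged to its voters.  An edge covered
     while a star S of the optimum spans x uncovered edges pays O(|S| / x), since
     up to a constant S is not denser than the chosen star; a harmonic sum over every optimal star
     and linearization of the logarithm give O(log (m / n)).
   - Time: let Phi_k be the sum over v of the number of edges spanned by the core
     of v at level k.  For the highest nonzero level, the voting argument of Jia,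
     Rajaraman and Suel makes Phi_k drop by a constant factor in expectation, so
     the single potential sum_k M^k Phi_k with M polynomial in n does too.  It
     starts at n^O(log Delta), whence O(log n log Delta) phases by Markov's
     inequality. *)
Require Import Defs.
From HB Require Import structures.
From mathcomp Require Import all_boot all_order all_algebra.
From mathcomp Require Import finmap zify ring lra.
From mathcomp Require Import reals sequences exp.

Set Implicit Arguments.
Unset Strict Implicit.
Unset Printing Implicit Defensive.

Import Order.TTheory GRing.Theory Num.Theory.
Local Open Scope fset_scope.
Local Open Scope nat_scope.

Local Notation edge := (nat * nat)%type.

(** * Cores and levels *)

Section Stars.
Implicit Types (E U S : {fset edge}) (e h : edge) (u v w k : nat).

Definition spans S v e := ((e.1, v) \in S) && ((v, e.2) \in S).

Definition cov U S v := [fset e in U | spans S v e].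

Definition sdeg U S v h :=
  #|` [fset e in cov U S v | (h == (e.1, v)) || (h == (v, e.2))] |.

Definition dense U k v S := all (fun h => 2 ^ k <= sdeg U S v h) S.

(** The union of all dense subsets of [E]. Density survives unions because [sdeg] is monotone in the
    set, so this is the largest dense subset. *)
Definition core E U k v :=
  [fset h in E | has (fun S => (h \in S) && dense U k v S) (fpowerset E)].

Lemma in_cov U S v e : (e \in cov U S v) = (e \in U) && spans S v e.
Proof. by rewrite !inE. Qed.

Lemma spans_sub S S' v e : S `<=` S' -> spans S v e -> spans S' v e.
Proof. by move=> /fsubsetP sS /andP[/sS h1 /sS h2]; apply/andP. Qed.

Lemma cov_sub U U' S S' v : U `<=` U' -> S `<=` S' -> cov U S v `<=` cov U' S' v.
Proof.
move=> /fsubsetP sU sS; apply/fsubsetP => e; rewrite !in_cov => /andP[/sU -> /=].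
exact: spans_sub.
Qed.

Lemma sdeg_sub U U' S S' v h :
  U `<=` U' -> S `<=` S' -> sdeg U S v h <= sdeg U' S' v h.
Proof.
move=> sU sS; apply: fsubset_leq_card; apply/fsubsetP => e; rewrite !inE.
move=> /andP[/andP[eU sp] ->]; rewrite (fsubsetP sU _ eU) andbT /=.
exact: spans_sub sp.
Qed.

Lemma denseP U k v S :
  reflect (forall h, h \in S -> 2 ^ k <= sdeg U S v h) (dense U k v S).
Proof. exact: allP. Qed.

Lemma coreP E U k v h :
  reflect (exists S, [/\ S `<=` E, h \in S & dense U k v S]) (h \in core E U k v).
Proof.
rewrite !inE; apply: (iffP andP) => [[hE /hasP[S]]|[S [sS hS dS]]].
  by rewrite fpowersetE => sS /andP[hS dS]; exists S.
split; first exact: (fsubsetP sS).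
by apply/hasP; exists S; rewrite ?fpowersetE // hS.
Qed.

Lemma core_subE E U k v : core E U k v `<=` E.
Proof. by apply/fsubsetP => h; rewrite !inE => /andP[]. Qed.

Lemma core_max E U k v S : S `<=` E -> dense U k v S -> S `<=` core E U k v.
Proof. by move=> sS dS; apply/fsubsetP => h hS; apply/coreP; exists S. Qed.

Lemma core_dense E U k v : dense U k v (core E U k v).
Proof.
apply/denseP => h /coreP[S [sS hS dS]].
apply: leq_trans (denseP _ _ _ _ dS _ hS) _.
by apply: sdeg_sub => //; apply: core_max.
Qed.

Lemma core_monoU E U U' k v : U' `<=` U -> core E U' k v `<=` core E U k v.
Proof.
move=> sU; apply: core_max; first exact: core_subE.
apply/denseP => h hc; apply: leq_trans (denseP _ _ _ _ (core_dense E U' k v) _ hc) _.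
exact: sdeg_sub.
Qed.

Lemma core_leq E U k k' v : k <= k' -> core E U k' v `<=` core E U k v.
Proof.
move=> lek; apply: core_max; first exact: core_subE.
apply/denseP => h hc; apply: leq_trans (denseP _ _ _ _ (core_dense E U k' v) _ hc).
by rewrite leq_exp2l.
Qed.

Lemma sdeg_gt0 U S v h : 0 < sdeg U S v h ->
  exists e, [/\ e \in U, spans S v e & h = (e.1, v) \/ h = (v, e.2)].
Proof.
rewrite cardfs_gt0 => /fset0Pn[e]; rewrite !inE => /andP[/andP[eU sp] /orP[]/eqP ->].
  by exists e; split=> //; left.
by exists e; split=> //; right.
Qed.

(** Double counting: a path through [v] has two edges, so each spanned edge is counted by at most
    two members of [S]. *)
Lemma dense_card U k v S : dense U k v S -> 2 ^ k * #|` S| <= 2 * #|` cov U S v|.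
Proof.
move=> /denseP dS.
apply: (@leq_trans (\sum_(h <- S) sdeg U S v h)).
  rewrite mulnC -sum1_size big_distrl /= big_seq [X in _ <= X]big_seq.
  by apply: leq_sum => h /dS; rewrite mul1n.
have sdegE h : sdeg U S v h =
    \sum_(e <- cov U S v) ((h == (e.1, v)) || (h == (v, e.2))).
  by rewrite /sdeg card_fset_sum1 big_fset /= big_mkcond.
under eq_bigr do rewrite sdegE.
rewrite exchange_big /= mulnC -sum1_size big_distrl /=.
apply: leq_sum => e _; rewrite mul1n.
have H (x : edge) : \sum_(h <- S) (h == x) <= 1.
  case: (boolP (x \in S)) => xS.
    rewrite (big_fsetD1 x) //= eqxx big_seq big1 // => h.
    by rewrite !inE => /andP[/negPf->].
  by rewrite big_seq big1 // => h hS; case: eqP => // hx; rewrite -hx hS in xS.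
apply: leq_trans (leq_add (H (e.1, v)) (H (v, e.2))).
rewrite -big_split /=; apply: leq_sum => h _.
by case: (h == _); case: (h == _).
Qed.

(** Peeling: deleting an edge of degree below 2^k loses fewer than 2^k spanned edges, so the density
    stays at least 2^k. The process stops at a dense set. *)
Lemma core_neq0 E U k v S : S `<=` E -> cov U S v != fset0 ->
  2 ^ k * #|` S| <= #|` cov U S v| -> core E U k v != fset0.
Proof.
have [n] := ubnP #|` S|; elim: n S => // n IHn S ltSn sS cS dS.
case: (boolP (dense U k v S)) => [dk|].
  apply: (fsubset_neq0 (core_max sS dk)).
  apply/negP => /eqP S0; move/negP: cS; apply; apply/eqP; apply/fsetP => e.
  by rewrite in_cov S0 /spans !in_fset0 /= andbF.
move=> /allPn[h hS]; rewrite -ltnNge => ltd.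
have cE : #|` cov U S v| = #|` cov U (S `\ h) v| + sdeg U S v h.
  rewrite -(cardfsID [fset e in cov U S v | (h == (e.1, v)) || (h == (v, e.2))]).
  rewrite addnC; congr (_ + _).
    congr #|` _|; apply/fsetP => e.
    rewrite !inE /= /spans !inE ![_ == h]eq_sym.
    by case: (e \in U); case: (h == _); case: (h == _); case: (_ \in S); case: (_ \in S).
  congr #|` _|; apply/fsetP => e; rewrite !inE.
  by case: (e \in U); case: (spans _ _ _); case: (_ || _).
have cardS : #|` S| = (#|` S `\ h|).+1 by rewrite (cardfsD1 h) hS.
(* The inequality is strict after a deletion, which keeps the spanned set nonempty. *)
have lt0 : 2 ^ k * #|` S `\ h| < #|` cov U (S `\ h) v|.
  by move: dS; rewrite cE cardS mulnS; move: ltd; lia.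
apply: (IHn (S `\ h)).
- by rewrite -ltnS -cardS.
- by apply: fsubset_trans sS; rewrite fsubsetDl.
- by rewrite -cardfs_gt0; apply: leq_ltn_trans lt0.
- exact: ltnW.
Qed.

Lemma core_neq0_cov E U k v : core E U k v != fset0 -> cov U (core E U k v) v != fset0.
Proof.
rewrite -!cardfs_gt0 => c0.
have := dense_card (core_dense E U k v).
by rewrite -[0 < #|` cov _ _ _|](ltn_pmul2l (m := 2)) // muln0; apply: leq_trans; rewrite muln_gt0 expn_gt0.
Qed.

Lemma core_bound E U k v : core E U k v != fset0 -> k < #|` U|.+1.
Proof.
move=> /fset0Pn[h hc]; have := denseP _ _ _ _ (core_dense E U k v) _ hc => le2.
have : sdeg U (core E U k v) v h <= #|` U|.
  by apply: fsubset_leq_card; apply/fsubsetP => e; rewrite !inE => /andP[/andP[]].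
move=> le3; rewrite ltnS; apply: leq_trans le3; apply: leq_trans le2.
by apply: ltnW; apply: ltn_expl.
Qed.

(** Shifted by one: a positive level l means that 2^(l-1) is the largest density with a nonempty
    core, and 0 that all cores are empty. [core_bound] justifies the finite range. *)
Definition lev E U v : nat :=
  \max_(k < #|` U|.+1 | core E U k v != fset0) k.+1.

Lemma lev_gt E U v k : (k < lev E U v) = (core E U k v != fset0).
Proof.
apply/idP/idP => [|c0].
  rewrite ltnNge => /negP lt; apply: contra_notT lt => /negPn/eqP c0.
  apply/bigmax_leqP => j; rewrite ltnNge; apply: contraNN => lekj.
  by rewrite -fsubset0 -c0; apply: core_leq.
have := core_bound c0 => ltk.
by apply: (leq_bigmax_cond (Ordinal ltk)).
Qed.

End Stars.

(** * One phase *)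

Section Phase.
Variables (E U : {fset edge}) (r : nat -> nat).
Implicit Types (e : edge) (v w : nat).

Definition mids e : seq nat :=
  [seq h.2 | h <- E & (h.1 == e.1) && spans E h.2 e].

Definition star v := core E U (lev E U v).-1 v.

Definition scov v := cov U (star v) v.

Definition cand v :=
  (0 < lev E U v) &&
  all (fun e => spans E v e ==> all (fun w => lev E U w <= lev E U v) (mids e)) U.

Definition cands e := [fset v in mids e | cand v && (e \in scov v)].

(** Ties between draws are broken by ID, so that votes are unique even when ranks collide. *)
Definition before v w := (r v < r w) || (r v == r w) && (v <= w).

Definition vote e v := (v \in cands e) && all (before v) (cands e).

Definition votes v := [fset e in scov v | vote e v].

Definition chosen v := cand v && (#|` scov v| <= 8 * #|` votes v|).

(** This includes the edges spanned by no two-edge path of [E], for which [mids e] is empty. *)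
Definition selfadd e := all (fun w => lev E U w == 0) (mids e).

Definition covered e := has (fun v => chosen v && (e \in scov v)) (mids e).

Definition remain := [fset e in U | ~~ (selfadd e || covered e)].

Definition added v :=
  (if chosen v then star v else fset0) `|` [fset e in U | (e.1 == v) && selfadd e].

Lemma mem_mids e v : (v \in mids e) = spans E v e.
Proof.
apply/mapP/idP => [[h]|sp].
  by rewrite mem_filter => /andP[/andP[_ sp] _] ->.
by exists (e.1, v) => //; rewrite mem_filter eqxx sp; case/andP: sp.
Qed.

Lemma in_cands e v : (v \in cands e) = cand v && (e \in scov v).
Proof.
rewrite !inE /= mem_mids; apply: andb_idl => /andP[_ /andP[_]].
by apply: spans_sub; apply: core_subE.
Qed.

Lemma in_votes e v : (e \in votes v) = (e \in scov v) && vote e v.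
Proof. by rewrite inE. Qed.

Lemma in_remain e : (e \in remain) = (e \in U) && ~~ (selfadd e || covered e).
Proof. by rewrite inE. Qed.

Lemma in_added e v : (e \in added v) =
  (chosen v && (e \in star v)) || [&& e \in U, e.1 == v & selfadd e].
Proof.
rewrite in_fsetU; congr (_ || _); first by case: (chosen v); rewrite ?in_fset0.
by rewrite inE.
Qed.

Lemma scov_spans e v : e \in scov v -> spans E v e.
Proof. by rewrite in_cov => /andP[_]; apply: spans_sub; apply: core_subE. Qed.

Lemma coveredP e :
  reflect (exists2 v, chosen v & e \in scov v) (covered e).
Proof.
apply: (iffP hasP) => [[v _ /andP[]]|[v cv ev]]; first by exists v.
by exists v; rewrite ?cv // mem_mids scov_spans.
Qed.

Lemma remain_sub : remain `<=` U.
Proof. by apply/fsubsetP => e; rewrite !inE => /andP[]. Qed.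

Lemma scov_neq0 v : 0 < lev E U v -> scov v != fset0.
Proof. by move=> l0; apply: core_neq0_cov; rewrite -lev_gt prednK. Qed.

Lemma before_total : total before.
Proof. by move=> v w; rewrite /before; case: ltngtP => //= _; case: ltngtP. Qed.

Lemma before_trans : transitive before.
Proof. by move=> v u w; rewrite /before; lia. Qed.

Lemma before_anti : antisymmetric before.
Proof. by move=> v w; rewrite /before; lia. Qed.

Lemma vote_inj e v w : vote e v -> vote e w -> v = w.
Proof.
move=> /andP[vc /allP vall] /andP[wc /allP wall]; apply: before_anti.
by rewrite vall ?wall.
Qed.

Lemma total_min (T : eqType) (R : rel T) (s : seq T) : transitive R -> total R ->
  s != [::] -> exists2 x, x \in s & all (R x) s.
Proof.
move=> Rt Rtot s0.
have := sort_sorted Rtot s; have : perm_eq (sort R s) s by rewrite perm_sort.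
case: (sort R s) => [|x s'] ps; first by rewrite -size_eq0 -(perm_size ps) in s0.
rewrite /= => px; exists x; first by rewrite -(perm_mem ps) mem_head.
rewrite -(perm_all _ ps) /= (order_path_min Rt px) andbT.
by have := Rtot x x; rewrite orbb.
Qed.

(** Progress for every outcome of the draws, which makes termination certain: the best ranked
    candidate wins the votes of all edges that it spans. *)
Lemma remain_lt : U != fset0 -> #|` remain| < #|` U|.
Proof.
move=> U0; suff [e eU rem] : exists2 e, e \in U & selfadd e || covered e.
  apply: fproper_ltn_card; rewrite fproperE remain_sub /=.
  by apply/fsubsetPn; exists e => //; rewrite !inE rem andbF.
case: (boolP (all selfadd U)) => [sU|].
  by have /fset0Pn[e eU] := U0; exists e => //; rewrite (allP sU).
move=> /allPn[e0 e0U /allPn[w0]]; rewrite mem_mids -lt0n => sp0 l0.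
pose W := [seq h.2 | h <- E].
have inW e w : spans E w e -> w \in W.
  by move=> /andP[h _]; apply/mapP; exists (e.1, w).
(* A centre of globally maximal level is a candidate, so candidates exist. *)
have [v vW vmax] : exists2 x, x \in W & all (fun w => lev E U w <= lev E U x) W.
  apply: (total_min (R := fun x w => lev E U w <= lev E U x)).
  - by move=> x y z xy yz; apply: leq_trans xy.
  - by move=> x y; apply: leq_total.
  - by apply: contraTneq (inW _ _ sp0) => ->.
have vc : cand v.
  apply/andP; split; first by apply: leq_trans l0 _; apply: (allP vmax); apply: inW sp0.
  apply/allP => e _; apply/implyP => _; apply/allP => w; rewrite mem_mids => /inW.
  by apply: (allP vmax).
have [u] : exists2 u, u \in [seq u <- W | cand u] & all (before u) [seq u <- W | cand u].
  apply: (total_min before_trans before_total).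
  by rewrite -has_filter; apply/hasP; exists v.
rewrite mem_filter => /andP[uc uW] umin.
have [e ec] := fset0Pn _ (scov_neq0 (proj1 (andP uc))).
exists e; first by move: ec; rewrite in_cov => /andP[].
apply/orP; right; apply/coveredP; exists u => //; rewrite /chosen uc /=.
suff -> : votes u = scov u by rewrite leq_pmull.
apply/fsetP => f; rewrite in_votes; apply: andb_idr => fu.
rewrite /vote in_cands uc fu /=; apply/allP => w; rewrite in_cands => /andP[wc fw].
by apply: (allP umin); rewrite mem_filter wc /= (inW f) // scov_spans.
Qed.

End Phase.

(** * Locality of a phase *)

Section Locality.
Variables (E U E' U' : {fset edge}) (r r' : nat -> nat).
Hypotheses (sE : E' `<=` E) (sU : U' `<=` U).

(* The view (E', U', r') is exact up to distance n around v, the distance being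
   counted in the graph joining the centres that span a common uncovered edge. *)
Fixpoint sees n v : Prop :=
  if n is n'.+1 then
    sees n' v /\
    forall e, e \in U -> spans E v e -> forall w, spans E w e -> sees n' w
  else forall e, e \in U -> spans E v e -> [/\ e \in U', spans E' v e & r' v = r v].

Lemma sees_le m n v : m <= n -> sees n v -> sees m v.
Proof. by move=> /subnK <-; elim: (n - m) => //= k IH [/IH]. Qed.

Lemma cov_loc v S : sees 0 v -> S `<=` E -> cov U' S v = cov U S v.
Proof.
move=> see sS; apply/eqP; rewrite eqEfsubset cov_sub //=.
apply/fsubsetP => e; rewrite !in_cov => /andP[eU sp]; rewrite sp andbT.
by have [] := see _ eU (spans_sub sS sp).
Qed.

Lemma core_loc k v : sees 0 v -> core E' U' k v = core E U k v.
Proof.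
move=> see; apply/eqP; rewrite eqEfsubset; apply/andP; split.
  apply: core_max; first by apply: fsubset_trans sE; apply: core_subE.
  apply/denseP => h hc; have := denseP _ _ _ _ (core_dense E' U' k v) _ hc.
  by move=> /leq_trans; apply; apply: sdeg_sub.
have d : dense U' k v (core E U k v).
  apply/denseP => h hc; have := denseP _ _ _ _ (core_dense E U k v) _ hc.
  by rewrite /sdeg (cov_loc see) // core_subE.
(* An edge of the core has positive degree, so it lies on a path through [v] spanning an uncovered
   edge; such paths are visible in [E']. *)
apply: core_max => //; apply/fsubsetP => h hc.
have := denseP _ _ _ _ d _ hc; rewrite -(leq_add2r 0) => le1.
have /sdeg_gt0[e [eU sp]] : 0 < sdeg U' (core E U k v) v h.
  by apply: leq_trans (expn_gt0 2 k) _; rewrite -(addn0 (2 ^ k)) -[sdeg _ _ _ _]addn0.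
have [_ /andP[s1 s2] _] := see _ (fsubsetP sU _ eU) (spans_sub (core_subE _ _ _ _) sp).
by case=> ->.
Qed.

Lemma lev_loc v : sees 0 v -> lev E' U' v = lev E U v.
Proof.
move=> see; apply/eqP; rewrite eqn_leq; apply/andP; split.
  rewrite leqNgt; apply/negP; rewrite lev_gt core_loc // -lev_gt ltnn //.
by rewrite leqNgt; apply/negP; rewrite lev_gt -core_loc // -lev_gt ltnn //.
Qed.

Lemma star_loc v : sees 0 v -> star E' U' v = star E U v.
Proof. by move=> see; rewrite /star lev_loc // core_loc. Qed.

Lemma scov_loc v : sees 0 v -> scov E' U' v = scov E U v.
Proof. by move=> see; rewrite /scov star_loc // cov_loc // core_subE. Qed.

Lemma mids_loc e : e \in U -> (forall w, spans E w e -> sees 0 w) ->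
  mids E' e =i mids E e.
Proof.
move=> eU see w; rewrite !mem_mids; apply/idP/idP; first exact: spans_sub.
by move=> sp; have [] := see _ sp _ eU sp.
Qed.

(** Candidacy compares the level of [v] with those of the centres sharing an uncovered edge, one
    unit of distance away. *)
Lemma cand_loc v : sees 1 v -> cand E' U' v = cand E U v.
Proof.
move=> [see nb]; rewrite /cand lev_loc //; congr (_ && _).
apply/allP/allP => all1 e eU; apply/implyP => sp; apply/allP => w wm.
  have [eU' sp' _] := see _ eU sp.
  have mE : mids E' e =i mids E e by apply: mids_loc => //; apply: nb.
  have := implyP (all1 _ eU') sp' => /allP/(_ w); rewrite mE lev_loc; first exact.
  by apply: nb eU sp _ _; rewrite -mem_mids.
have eU1 := fsubsetP sU _ eU; have sp1 := spans_sub sE sp.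
have wm1 : w \in mids E e by rewrite mem_mids (spans_sub sE) // -mem_mids.
have := implyP (all1 _ eU1) sp1 => /allP/(_ w wm1); rewrite lev_loc //.
by apply: nb eU1 sp1 _ _; rewrite -mem_mids.
Qed.

Lemma cands_loc e : e \in U -> (forall w, spans E w e -> sees 1 w) ->
  cands E' U' e = cands E U e.
Proof.
move=> eU see; apply/fsetP => w; rewrite [LHS]in_cands [RHS]in_cands.
apply/andP/andP => -[wc ew].
  have [see0 see1] := see _ (spans_sub sE (scov_spans ew)).
  by rewrite -(cand_loc (conj see0 see1)) -(scov_loc see0).
have [see0 see1] := see _ (scov_spans ew).
by rewrite (cand_loc (conj see0 see1)) (scov_loc see0).
Qed.

Lemma vote_loc e v : e \in U -> (forall w, spans E w e -> sees 1 w) ->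
  vote E' U' r' e v = vote E U r e v.
Proof.
move=> eU see; rewrite /vote cands_loc //.
case: (boolP (v \in cands E U e)) => //= vc.
have rE w : w \in cands E U e -> r' w = r w.
  rewrite in_cands => /andP[_ /scov_spans sp].
  by have [s0 _] := see _ sp; have [] := s0 _ eU sp.
by apply/eq_in_all => w wc; rewrite /before !rE.
Qed.

(** A vote on an edge spanned by [v] depends on the candidacy of every centre of that edge, hence a
    second unit of distance. *)
Lemma votes_loc v : sees 2 v -> votes E' U' r' v = votes E U r v.
Proof.
move=> [[see0 see] nb]; apply/fsetP => e.
rewrite [LHS]in_votes [RHS]in_votes (scov_loc see0).
apply: andb_id2l => ev.
have eU : e \in U by move: ev; rewrite in_cov => /andP[].
by apply: vote_loc => //; apply: nb => //; apply: scov_spans ev.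
Qed.

Lemma chosen_loc v : sees 2 v -> chosen E' U' r' v = chosen E U r v.
Proof.
move=> see; rewrite /chosen (votes_loc see) (scov_loc (sees_le (leq0n 2) see)).
by rewrite (cand_loc (sees_le (leqnSn 1) see)).
Qed.

Lemma selfadd_loc e : e \in U -> (forall w, spans E w e -> sees 0 w) ->
  selfadd E' U' e = selfadd E U e.
Proof.
move=> eU see; apply/allP/allP => all0 w; rewrite ?mids_loc // => wm.
  by rewrite -lev_loc ?all0 ?mids_loc //; apply: see; rewrite -mem_mids.
by rewrite lev_loc ?all0 //; apply: see; rewrite -mem_mids.
Qed.

Lemma covered_loc e : e \in U -> (forall w, spans E w e -> sees 2 w) ->
  covered E' U' r' e = covered E U r e.
Proof.
move=> eU see.
have see0 w : spans E w e -> sees 0 w by move=> /see; apply: sees_le.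
have mE : mids E' e =i mids E e by apply: mids_loc.
apply/coveredP/coveredP => -[v cv ev]; exists v.
- by rewrite -chosen_loc //; apply: see; apply: (spans_sub sE); apply: scov_spans ev.
- rewrite -scov_loc //; apply: see0; apply: (spans_sub sE); apply: scov_spans ev.
- by rewrite chosen_loc //; apply: see; apply: scov_spans ev.
- by rewrite scov_loc //; apply: see0; apply: scov_spans ev.
Qed.

Lemma remain_loc e : e \in U' -> (forall w, spans E w e -> sees 2 w) ->
  (e \in remain E' U' r') = (e \in remain E U r).
Proof.
move=> eU' see; have eU := fsubsetP sU _ eU'.
have see0 w : spans E w e -> sees 0 w by move=> /see; apply: sees_le.
by rewrite !in_remain eU eU' /= (covered_loc eU see) (selfadd_loc eU see0).
Qed.

(** The second hypothesis concerns the edges leaving [v] that may add themselves, where [v] is an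
    endpoint and not a centre. *)
Lemma added_loc v : sees 2 v ->
  (forall e, e \in U -> e.1 = v -> e \in U' /\ forall w, spans E w e -> sees 0 w) ->
  added E' U' r' v = added E U r v.
Proof.
move=> see out; apply/fsetP => e; rewrite [LHS]in_added [RHS]in_added (chosen_loc see).
rewrite star_loc; last exact: sees_le see.
congr (_ || _); case: (eqVneq e.1 v) => [ev|_]; last by rewrite !andbF.
case: (boolP (e \in U)) => [eU|eU] /=.
  by have [-> se] := out _ eU ev; rewrite selfadd_loc.
by rewrite (negPf (contra (fsubsetP sU e) eU)).
Qed.

End Locality.

(** * Cost of a phase *)

Lemma in_sep (T : choiceType) (A : {fset T}) (P : pred T) x :
  (x \in [fset x in A | P x]) = (x \in A) && P x.
Proof. by rewrite !inE. Qed.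

Lemma card_sum_fset (T : choiceType) (A : {fset T}) (P : pred T) :
  #|` [fset x in A | P x]| = \sum_(x <- A) P x.
Proof. by rewrite card_fset_sum1 big_fset /= big_mkcond. Qed.

Lemma size_sum_fset (T : choiceType) (A : {fset T}) : #|` A| = \sum_(x <- A) 1.
Proof. by rewrite -sum1_size. Qed.

Definition centres (E : {fset edge}) := [fset h.2 | h in E].

Lemma spans_centres E v e : spans E v e -> v \in centres E.
Proof. by move=> /andP[h _]; apply/imfsetP; exists (e.1, v). Qed.

Definition additions E U r :=
  (\bigcup_(v <- centres E | chosen E U r v) star E U v) `|`
  [fset e in U | selfadd E U e].

Section Price.
Local Open Scope ring_scope.
Variables (R : realType) (E U : {fset edge}) (r : nat -> nat).
Implicit Types (e : edge) (v w : nat).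

(** An edge pays 1 for adding itself, or the inverse density level of the chosen star that it votes
    for. *)
Definition price (e : edge) : R :=
  (selfadd E U e)%:R +
  \sum_(v <- centres E | vote E U r e v && chosen E U r v) (2 ^+ (lev E U v).-1)^-1.

Lemma voteP e v : vote E U r e v ->
  [/\ cand E U v, e \in scov E U v, spans E v e & e \in U].
Proof.
case/andP; rewrite in_cands => /andP[cv ev] _; split => //; first exact: scov_spans ev.
by move: ev; rewrite in_cov => /andP[].
Qed.

Lemma cand_lev_ge e v w : cand E U v -> e \in U -> spans E v e -> spans E w e ->
  (0 < lev E U v)%N /\ (lev E U w <= lev E U v)%N.
Proof.
case/andP => l0 /allP all1 eU sv sw; split => //.
by have /implyP/(_ sv)/allP := all1 _ eU; apply; rewrite mem_mids.
Qed.

(** Self-addition forces the level 0 on all centres of [e] and so excludes voting; a vote goes to at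
    most one centre. *)
Lemma price_cases e : e \in U ->
  [\/ price e = 0,
      selfadd E U e /\ price e = 1
    | exists v, [/\ vote E U r e v, chosen E U r v & price e = (2 ^+ (lev E U v).-1)^-1]].
Proof.
move=> eU; rewrite /price; case: (boolP (selfadd E U e)) => [sa|_].
  constructor 2; split => //.
  rewrite big1 ?addr0 // => v /andP[/voteP[/andP[l0 _] _ sp _] _].
  by move: l0; rewrite (eqP (allP sa _ _)) // mem_mids.
rewrite add0r.
case: (boolP (has (fun v => vote E U r e v && chosen E U r v) (centres E))) => [|no].
  move=> /hasP[v vV /andP[vv cv]]; constructor 3; exists v; split => //.
  rewrite big_mkcond (big_fsetD1 v) //= vv cv /= big_seq_cond big1 ?addr0 // => w.
  rewrite !inE => /andP[/andP[nvw _] _]; case: ifP => // /andP[vw _].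
  by rewrite (vote_inj vw vv) eqxx in nvw.
constructor 1; rewrite big_seq_cond big_pred0 // => v.
by apply/negbTE; apply: contra no => /andP[vV vc]; apply/hasP; exists v.
Qed.

Lemma price_ge0 e : 0 <= price e.
Proof.
rewrite addr_ge0 ?ler0n // sumr_ge0 // => v _.
by rewrite invr_ge0 exprn_ge0.
Qed.

Lemma price_le1 e : e \in U -> price e <= 1.
Proof.
move=> /price_cases[->|[_ ->]|[v [_ _ ->]]] //.
by rewrite invf_le1 ?exprn_gt0 // exprn_ege1 // ler1n.
Qed.

Lemma price_remain e : e \in remain E U r -> price e = 0.
Proof.
rewrite in_remain negb_or => /and3P[eU /negPf sa /coveredP cv].
case: (price_cases eU) => // [[]|[v [/voteP[_ ev _ _] vc _]]]; first by rewrite sa.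
by case: cv; exists v.
Qed.

(** The centre that [e] votes for has a level at least that of [w], so the density of [S] is at most
    2^lev, twice the density level of the chosen star. If [e] adds itself, the level of [w] is 0. *)
Lemma price_star e w (S : {fset edge}) : S `<=` E -> e \in cov U S w ->
  price e * #|` cov U S w|%:R <= 2 * #|` S|%:R.
Proof.
move=> sS ew; have /andP[eU sp] : (e \in U) && spans S w e by rewrite -in_cov.
have spE := spans_sub sS sp.
have c0 : cov U S w != fset0 by apply/fset0Pn; exists e.
(* Contrapositive of [core_neq0]: a denser [S] would give [w] a higher level. *)
have bound k : (lev E U w <= k)%N -> (#|` cov U S w| <= 2 ^ k * #|` S|)%N.
  move=> lek; rewrite leqNgt; apply: contraTN lek => /ltnW le.
  by rewrite -ltnNge lev_gt (core_neq0 sS c0).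
case: (price_cases eU) => [->|[sa ->]|[v [/voteP[vc _ spv _] _ ->]]].
- by rewrite mul0r mulr_ge0 // ler0n.
- rewrite mul1r -natrM ler_nat.
  have := bound 0%N; rewrite (eqP (allP sa w _)) ?mem_mids // => /(_ isT); lia.
have [l0 le] := cand_lev_ge vc eU spv spE.
rewrite mulrC ler_pdivrMr ?exprn_gt0 // -natrX -!natrM ler_nat.
have := bound _ le; rewrite -{1}(prednK l0) expnS; lia.
Qed.

(** The factor 16 is 2 from [dense_card] times 8 from the voting threshold. *)
Lemma additions_price :
  #|` additions E U r|%:R <= 16 * \sum_(e <- U) price e.
Proof.
rewrite /additions; set B := \bigcup_(v <- _ | _) _.
have cB : (#|` B| <= \sum_(v <- centres E | chosen E U r v) #|` star E U v|)%N.
  rewrite /B; elim/big_rec2: _ => [|v n A _ le]; first by rewrite cardfs0.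
  by apply: leq_trans (leq_card_fsetU _ _).1 _; rewrite leq_add2l.
have cU : #|` B `|` [fset e in U | selfadd E U e]|%:R <=
    (\sum_(v <- centres E | chosen E U r v) #|` star E U v|)%N%:R +
    (\sum_(e <- U) selfadd E U e)%N%:R :> R.
  rewrite -natrD ler_nat -card_sum_fset.
  by apply: leq_trans (leq_card_fsetU _ _).1 _; rewrite leq_add2r.
apply: le_trans cU _; rewrite /price big_split /= mulrDr [leRHS]addrC lerD //; last first.
  by rewrite natr_sum ler_peMl ?sumr_ge0 // ler1n.
rewrite (exchange_big_dep (chosen E U r)) /=; last by move=> e v _ /andP[].
rewrite natr_sum mulr_sumr ler_sum // => v vc.
under eq_bigl do rewrite vc andbT.
rewrite big_mkcond /=.
have -> : \sum_(e <- U) (if vote E U r e v then (2 ^+ (lev E U v).-1)^-1 else 0)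
    = #|` votes E U r v|%:R / 2 ^+ (lev E U v).-1 :> R.
  have -> : #|` votes E U r v| = (\sum_(e <- U) vote E U r e v)%N.
    rewrite -card_sum_fset; congr #|` _|; apply/fsetP => e.
    rewrite [LHS]in_votes [RHS]in_sep; apply/andP/andP => -[h1 h2]; split => //.
      by move: h1; rewrite in_cov => /andP[].
    by have [] := voteP h2.
  rewrite natr_sum mulr_suml; apply: eq_bigr => e _.
  by case: (vote _ _ _ _ _); rewrite ?mul1r ?mul0r.
rewrite mulrA ler_pdivlMr ?exprn_gt0 // -natrX -!natrM ler_nat.
have [/andP[l0 _] le8] := andP vc.
have d : (2 ^ (lev E U v).-1 * #|` star E U v| <= 2 * #|` scov E U v|)%N.
  exact: dense_card (core_dense E U (lev E U v).-1 v).
rewrite mulnC; apply: leq_trans d _.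
by rewrite -[16%N]/(2 * 8)%N -mulnA leq_mul2l le8.
Qed.

End Price.

(** * Truncated harmonic sums *)

Section Harmonic.
Local Open Scope ring_scope.
Variable R : realType.

(** Bounds the total paid by [x] edges when each pays at most min (1, s / y) while [y] of them are
    left. *)
Definition harm (s : R) (x : nat) : R := \sum_(1 <= y < x.+1) Num.min 1 (s / y%:R).

Lemma harm_ge0 s x : 0 <= s -> 0 <= harm s x.
Proof.
by move=> s0; rewrite sumr_ge0 // => y _; rewrite le_min ler01 divr_ge0.
Qed.

(** The [d] terms that disappear have index [y] at most [x], so each of them is at least [p]. *)
Lemma harm_drop s x d (p : R) : 0 <= s -> (d <= x)%N -> p <= 1 -> p * x%:R <= s ->
  d%:R * p <= harm s x - harm s (x - d).
Proof.
move=> s0 ledx p1 px; rewrite /harm.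
rewrite (@big_cat_nat _ _ _ (x - d).+1 1 x.+1) //=; last by rewrite ltnS leq_subr.
rewrite addrAC subrr add0r.
have -> : d%:R * p = \sum_((x - d).+1 <= y < x.+1) p.
  by rewrite big_const_nat subSS subKn // iter_addr_0 mulr_natl.
apply: ler_sum_nat => y /andP[lty leyx].
have y0 : 0 < y%:R :> R by rewrite ltr0n; apply: leq_trans lty.
rewrite le_min p1 ler_pdivlMr //=.
have [p0|p0] := leP 0 p; last by apply: le_trans s0; rewrite mulr_le0_ge0 // ltW.
by apply: le_trans px; rewrite ler_wpM2l // ler_nat -ltnS.
Qed.

Lemma harm_le s x : harm s x <= x%:R.
Proof.
rewrite /harm; apply: (@le_trans _ _ (\sum_(1 <= y < x.+1) 1)).
  by apply: ler_sum => y _; rewrite ge_min lexx.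
by rewrite big_const_nat subSS subn0 iter_addr_0.
Qed.

Lemma ln_succ (y : nat) : (0 < y)%N -> (y.+1%:R)^-1 <= ln (y.+1%:R) - ln y%:R :> R.
Proof.
move=> y0; have y0' : 0 < y%:R :> R by rewrite ltr0n.
have s0 : 0 < y.+1%:R :> R by rewrite ltr0n.
(* The inequality ln (1 + t) <= t at t = - 1 / (y + 1), where 1 + t = y / (y + 1). *)
have := @le_ln1Dx R (- (y.+1%:R)^-1).
have -> : 1 + - (y.+1%:R)^-1 = y%:R / y.+1%:R :> R.
  by rewrite -natr1; field; rewrite natr1 gt_eqF.
rewrite lnM ?posrE ?invr_gt0 // lnV ?posrE // => H.
have : - 1 < - (y.+1%:R)^-1 :> R by rewrite ltrN2 invf_lt1 // ltr1n.
by move/H => {}H; rewrite -lerN2 opprB.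
Qed.

(** The first [s] terms are at most 1 each, and the others are compared with a telescoping
    logarithm. *)
Lemma harm_ln (s x : nat) : (0 < s)%N -> (s <= x)%N ->
  harm s%:R x <= s%:R + s%:R * (ln x%:R - ln s%:R).
Proof.
move=> s0 /subnK <-; elim: (x - s)%N => [|k IH].
  by rewrite add0n subrr mulr0 addr0 harm_le.
rewrite addSn /harm big_nat_recr //= -/(harm _ _).
have H : (s%:R / (k + s).+1%:R) <= s%:R * (ln (k + s).+1%:R - ln (k + s)%:R) :> R.
  by rewrite ler_wpM2l // ln_succ // addn_gt0 s0 orbT.
have M : Num.min 1 (s%:R / (k + s).+1%:R) <= s%:R / (k + s).+1%:R :> R.
  by rewrite ge_min lexx orbT.
apply: le_trans (lerD IH (le_trans M H)) _.
by rewrite -addrA -mulrDr [ln (k + s)%:R - _]addrC addrACA subrr addr0 [- _ + _]addrC.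
Qed.

(* The slope 1 / L replaces Jensen's inequality when this is summed over stars. *)
Lemma harm_linear (s x : nat) (L : R) : 0 < L ->
  harm s%:R x <= 2 * s%:R * Num.max 1 (ln L) + x%:R / L.
Proof.
move=> L0; set M := Num.max _ _.
have M1 : 1 <= M by rewrite le_max lexx.
have ML : ln L <= M by rewrite le_max lexx orbT.
have s0R : 0 <= s%:R :> R by rewrite ler0n.
have xL : 0 <= x%:R / L by rewrite divr_ge0 // ltW.
have sM : s%:R <= s%:R * M by rewrite ler_peMr.
have [ltxs|lesx] := ltnP x s.
  have := harm_le s%:R x; have : x%:R <= s%:R :> R by rewrite ler_nat ltnW.
  by move: sM xL s0R; lra.
have [s_eq0|s0] := posnP s.
  rewrite s_eq0 mulr0 mul0r add0r /harm big1 // => y _.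
  by rewrite mul0r; apply/min_idPr; rewrite ler01.
have s0' : 0 < s%:R :> R by rewrite ltr0n.
have x0' : 0 < x%:R :> R by rewrite ltr0n; apply: leq_trans lesx.
have := harm_ln s0 lesx.
have y0 : 0 < x%:R / (s%:R * L) :> R by rewrite divr_gt0 // mulr_gt0.
(* Linearization: ln y <= y at y = x / (s L) bounds s ln (x / s) by s ln L + x / L. *)
have : ln (x%:R / (s%:R * L)) <= x%:R / (s%:R * L) :> R.
  by apply: ltW; apply: ln_sublinear.
rewrite lnM ?posrE ?invr_gt0 ?mulr_gt0 // lnV ?posrE ?mulr_gt0 // lnM ?posrE // => H.
have : s%:R * (ln x%:R - (ln s%:R + ln L)) <= x%:R / L.
  apply: le_trans (ler_wpM2l s0R H) _.
  by rewrite invfM mulrCA (mulrA s%:R) mulfV ?mul1r // gt_eqF.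
have : s%:R * ln L <= s%:R * M by rewrite ler_wpM2l.
by move: sM; rewrite !mulrBr !mulrDr; lra.
Qed.

End Harmonic.

(** * Amortization against a fixed spanner *)

Section Debt.
Local Open Scope ring_scope.
Variables (R : realType) (E H : {fset edge}).
Hypotheses (sH : H `<=` E)
  (spanH : forall e, e \in E -> e \in H \/ exists w, spans H w e).
Implicit Types (U : {fset edge}) (e : edge) (w : nat).

Definition ray w := [fset h in H | (h.1 == w) || (h.2 == w)].

(** The default 0 is never reached for an edge of [E] outside [H], by [payer_spans]. *)
Definition payer e : nat := head 0%N (mids H e).

Definition bill U w := [fset e in U `\` H | payer e == w].

(* Upper bound on the total price still to be charged when U is uncovered: each
   edge outside the spanner H is billed to one centre spanning it in H. *)
Definition debt U : R :=
  #|` U `&` H|%:R +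
  \sum_(w <- centres E) harm (2 * #|` ray w|%:R) #|` bill U w|.

Lemma in_bill U w e : (e \in bill U w) = [&& e \in U, e \notin H & payer e == w].
Proof. by rewrite in_sep in_fsetD andbC [_ && (e \in U)]andbC andbC andbA. Qed.

Lemma payer_spans e : e \in E -> e \notin H -> spans H (payer e) e.
Proof.
move=> eE eH; have [|[w sp]] := spanH eE; first by rewrite (negPf eH).
have : w \in mids H e by rewrite mem_mids.
rewrite -mem_mids /payer; case: (mids H e) => //= a s _.
exact: mem_head.
Qed.

Lemma payer_centre e : e \in E -> e \notin H -> payer e \in centres E.
Proof. by move=> eE /(payer_spans eE)/(spans_sub sH)/spans_centres. Qed.

Lemma ray_sub w : ray w `<=` E.
Proof. by apply: fsubset_trans sH; apply/fsubsetP => h; rewrite in_sep => /andP[]. Qed.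

Lemma bill_cov U w : U `<=` E -> bill U w `<=` cov U (ray w) w.
Proof.
move=> /fsubsetP sU; apply/fsubsetP => e; rewrite in_bill in_cov.
move=> /and3P[eU eH /eqP <-]; rewrite eU /=.
have /andP[h1 h2] := payer_spans (sU _ eU) eH.
by apply/andP; rewrite !in_sep h1 h2 /= !eqxx orbT.
Qed.

Lemma debt_ge0 U : 0 <= debt U.
Proof.
rewrite addr_ge0 // ?ler0n // sumr_ge0 // => w _.
by rewrite harm_ge0 // mulr_ge0.
Qed.

Lemma sum_split_payer (A : {fset edge}) (f : edge -> R) : A `<=` E ->
  \sum_(e <- A) f e = \sum_(e <- A `&` H) f e +
    \sum_(w <- centres E) \sum_(e <- bill A w) f e.
Proof.
move=> /fsubsetP sA; rewrite (big_fsetID _ (mem H)) /=; congr (_ + _).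
  by apply: eq_fbigl => e; rewrite in_sep in_fsetI.
have bE w : \sum_(e <- bill A w) f e =
    \sum_(e <- [fset x in A | x \notin H]) if payer e == w then f e else 0.
  have -> : bill A w = [fset e in [fset x in A | x \notin H] | payer e == w].
    by apply/fsetP => e; rewrite in_bill !in_sep andbA.
  by rewrite big_fset /= big_mkcond.
under [in RHS]eq_bigr do rewrite bE.
rewrite exchange_big /= big_seq [RHS]big_seq; apply: eq_bigr => e.
rewrite in_sep => /andP[eA eH].
rewrite (big_fsetD1 (payer e)) /= ?payer_centre ?sA // eqxx big_seq big1 ?addr0 // => w.
by rewrite in_fsetD1 eq_sym => /andP[/negPf ->].
Qed.

(** Only edges covered in this phase pay. Those in [H] pay at most 1. Those billed to [w] pay at
    most twice the size of the ray over the number of edges billed to [w] before the phase, by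
    [price_star], so [harm_drop] applies at each [w]. *)
Lemma debt_step U r : U `<=` E ->
  #|` additions E U r|%:R <= 16 * (debt U - debt (remain E U r)).
Proof.
move=> sU; apply: le_trans (additions_price _ _ _ _) _; rewrite ler_pM2l //.
set U' := remain E U r; have sU' : U' `<=` U by apply: remain_sub.
pose A := U `\` U'.
have sA : A `<=` U by rewrite fsubsetDl.
have -> : \sum_(e <- U) price R E U r e = \sum_(e <- A) price R E U r e.
  apply/esym/big_fset_incl => // e eU; rewrite in_fsetD eU andbT negbK.
  exact: price_remain.
rewrite sum_split_payer; last exact: fsubset_trans sU.
rewrite /debt opprD addrACA lerD //.
  apply: (@le_trans _ _ (\sum_(e <- A `&` H) 1%:R)).
    rewrite big_seq [leRHS]big_seq ler_sum // => e; rewrite in_fsetI => /andP[eA _].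
    by apply: price_le1; apply: (fsubsetP sA).
  rewrite -natr_sum -size_sum_fset lerBrDr -natrD ler_nat.
  rewrite -cardfsUI [X in (_ + X)%N](_ : _ = 0%N) ?addn0; last first.
    apply/eqP; rewrite cardfs_eq0; apply/eqP/fsetP => e.
    by rewrite !in_fsetI in_fsetD in_fset0; case: (e \in U'); rewrite ?andbF.
  apply: fsubset_leq_card; apply/fsubsetP => e; rewrite in_fsetU !in_fsetI.
  by move=> /orP[]/andP[h ->]; rewrite andbT; apply: fsubsetP h.
rewrite -sumrB ler_sum // => w _.
have cB : (#|` bill U' w| = #|` bill U w| - #|` bill A w|)%N.
  rewrite -cardfsDS; last first.
    by apply/fsubsetP => e; rewrite !in_bill => /and3P[/(fsubsetP sA) -> -> ->].
  congr #|` _|; apply/fsetP => e; rewrite in_fsetD !in_bill in_fsetD.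
  move: (fsubsetP sU' e); case: (e \in U') => [/(_ isT) -> //|_ /=].
  by rewrite andNb.
have sB : bill A w `<=` bill U w.
  by apply/fsubsetP => e; rewrite !in_bill => /and3P[/(fsubsetP sA) -> -> ->].
set x := #|` bill U w|; set s := 2 * _.
have s0 : 0 <= s by rewrite mulr_ge0 ?ler0n.
pose p : R := Num.min 1 (s / x%:R).
have ple e : e \in bill A w -> price R E U r e <= p.
  move=> eB; have eBU := fsubsetP sB _ eB.
  have eU : e \in U by move: eBU; rewrite in_bill => /andP[].
  have x0 : 0 < x%:R :> R by rewrite ltr0n cardfs_gt0; apply/fset0Pn; exists e.
  rewrite le_min price_le1 //= ler_pdivlMr //.
  have eC := fsubsetP (bill_cov w sU) _ eBU.
  apply: le_trans (price_star R r (ray_sub w) eC).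
  by rewrite ler_wpM2l ?price_ge0 // ler_nat fsubset_leq_card // bill_cov.
apply: (@le_trans _ _ (#|` bill A w|%:R * p)).
  rewrite size_sum_fset natr_sum mulr_suml big_seq [leRHS]big_seq ler_sum // => e.
  by rewrite mul1r; apply: ple.
rewrite cB harm_drop //; first exact: fsubset_leq_card.
  by rewrite /p ge_min lexx.
have [x0|x0] := posnP x; first by rewrite x0 mulr0.
by rewrite -ler_pdivlMr ?ltr0n // /p ge_min lexx orbT.
Qed.

(** The constant is 1 + 8 + 2: the edges of [H], the logarithmic terms of [harm_linear], and its
    linear terms, which for L = |E| / n add up to at most n <= 2 |H|. *)
Lemma debt_init (n : nat) : (0 < #|` E|)%N -> (0 < n)%N -> (n <= 2 * #|` H|)%N ->
  debt E <= 11 * Num.max 1 (ln (#|` E|%:R / n%:R)) * #|` H|%:R.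
Proof.
move=> m0 n0 len; set L := _ / _; set M := Num.max _ _.
have m0' : 0 < #|` E|%:R :> R by rewrite ltr0n.
have n0' : 0 < n%:R :> R by rewrite ltr0n.
have L0 : 0 < L by rewrite divr_gt0.
have M1 : 1 <= M by rewrite le_max lexx.
have c1 : #|` E `&` H|%:R <= #|` H|%:R :> R.
  by rewrite ler_nat fsubset_leq_card // fsubsetIr.
(* An edge of [H] belongs to the rays of its two endpoints only. *)
have c2 : (\sum_(w <- centres E) #|` ray w| <= 2 * #|` H|)%N.
  rewrite (eq_bigr (fun w => \sum_(h <- H) ((h.1 == w) || (h.2 == w)))%N); last first.
    by move=> w _; rewrite card_sum_fset.
  rewrite exchange_big /= size_sum_fset big_distrr /= leq_sum // => h _.
  have one a : (\sum_(w <- centres E) (a == w) <= 1)%N.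
    rewrite -(card_sum_fset (centres E) (fun w => a == w)) -(cardfs1 a).
    by apply: fsubset_leq_card; apply/fsubsetP => w; rewrite in_sep in_fset1 eq_sym => /andP[].
  apply: leq_trans (leq_add (one h.1) (one h.2)).
  by rewrite -big_split /= leq_sum // => w _; case: (_ == w); case: (_ == w).
have c3 : (\sum_(w <- centres E) #|` bill E w| <= #|` E|)%N.
  have := sum_split_payer (fun=> 1%:R) (fsubset_refl E).
  rewrite -natr_sum -size_sum_fset => eqE.
  rewrite -(ler_nat R) eqE natr_sum -[leLHS]add0r lerD ?sumr_ge0 //.
  by rewrite le_eqVlt; apply/orP; left; apply/eqP/eq_bigr => w _; rewrite -natr_sum -size_sum_fset.
have : \sum_(w <- centres E) harm (2 * #|` ray w|%:R) #|` bill E w| <=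
    4 * M * (\sum_(w <- centres E) #|` ray w|)%N%:R +
    (\sum_(w <- centres E) #|` bill E w|)%N%:R / L :> R.
  rewrite !natr_sum mulr_sumr mulr_suml -big_split ler_sum //= => w _.
  rewrite -natrM; apply: le_trans (harm_linear _ _ L0) _.
  by rewrite -/M lerD2r natrM le_eqVlt; apply/orP; left; apply/eqP; ring.
have c3' : (\sum_(w <- centres E) #|` bill E w|)%N%:R / L <= 2 * #|` H|%:R :> R.
  rewrite ler_pdivrMr //; apply: (@le_trans _ _ #|` E|%:R); first by rewrite ler_nat.
  rewrite /L mulrA ler_pdivlMr // mulrC ler_wpM2r ?ler0n //.
  by rewrite -natrM ler_nat.
have c2' : 4 * M * (\sum_(w <- centres E) #|` ray w|)%N%:R <= 8 * M * #|` H|%:R :> R.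
  have -> : 8 * M * #|` H|%:R = 4 * M * (2 * #|` H|)%N%:R by rewrite natrM; ring.
  by rewrite ler_wpM2l ?ler_nat // mulr_ge0 // (le_trans ler01).
have c4 : #|` H|%:R <= M * #|` H|%:R :> R by rewrite ler_peMl ?ler0n.
move: c1 c2' c3' c4; rewrite /debt.
by move: (\sum_(w <- _) harm _ _) ( _ / L) (_ * (\sum_(w <- _) _)%:R) => a b c; nra.
Qed.

End Debt.

(** * Expected progress *)

(** Let [m] be the least value such that at least half of [A] has [f] at most [m]. Every element
    with [f] at least [m] qualifies, and fewer than half lie strictly below [m]. *)
Lemma upper_half (T : choiceType) (A : {fset T}) (f : T -> nat) :
  #|` A| <=
  2 * #|` [fset x in A | #|` A| <= 2 * #|` [fset y in A | f y <= f x]|]|.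
Proof.
pose c t := #|` [fset y in A | f y <= t]|.
have c_mono t t' : t <= t' -> c t <= c t'.
  move=> le; apply: fsubset_leq_card; apply/fsubsetP => y; rewrite !in_sep.
  by move=> /andP[-> /leq_trans]; apply.
have [t0 Pt0] : exists t, #|` A| <= 2 * c t.
  exists (\max_(y <- A) f y); rewrite /c.
  rewrite [X in _ <= 2 * #|` X|](_ : _ = A) ?leq_pmull //.
  apply/fsetP => y; rewrite in_sep; apply: andb_idr => yA.
  by rewrite (big_fsetD1 y) //= leq_maxl.
have ex : exists t, #|` A| <= 2 * c t by exists t0.
case: (ex_minnP ex) => m Pm min_m.
have sub : [fset x in A | m <= f x] `<=`
    [fset x in A | #|` A| <= 2 * #|` [fset y in A | f y <= f x]|].
  apply/fsubsetP => x; rewrite !in_sep => /andP[-> lemx] /=.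
  by apply: leq_trans Pm _; rewrite leq_mul2l /= c_mono.
apply: leq_trans (_ : 2 * #|` [fset x in A | m <= f x]| <= _); last first.
  by rewrite leq_mul2l fsubset_leq_card.
case: (posnP m) => [->|m0].
  rewrite [X in _ <= 2 * #|` X|](_ : _ = A) ?leq_pmull //.
  by apply/fsetP => y; rewrite in_sep andbT.
have np : 2 * c m.-1 < #|` A|.
  by rewrite ltnNge; apply/negP => /min_m; rewrite leqNgt ltn_predL m0.
have : #|` A| = c m.-1 + #|` [fset x in A | m <= f x]|.
  rewrite /c !card_sum_fset size_sum_fset -big_split /=.
  by apply: eq_bigr => x _; rewrite -ltnS prednK //; case: ltnP.
by move: np; lia.
Qed.

(** * Expectation on a finite uniform space *)

Section Expectation.
Local Open Scope ring_scope.
Variables (R : realType) (Om : finType).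

Definition Ex (f : Om -> R) : R := (\sum_w f w) / #|Om|%:R.

Lemma ExD f g : Ex (fun w => f w + g w) = Ex f + Ex g.
Proof. by rewrite /Ex big_split mulrDl. Qed.

Lemma ExZ a f : Ex (fun w => a * f w) = a * Ex f.
Proof. by rewrite /Ex -mulr_sumr mulrA. Qed.

Lemma ExN f : Ex (fun w => - f w) = - Ex f.
Proof. by rewrite /Ex sumrN mulNr. Qed.

Lemma Ex_sum (T : Type) (s : seq T) (P : pred T) (f : T -> Om -> R) :
  Ex (fun w => \sum_(x <- s | P x) f x w) = \sum_(x <- s | P x) Ex (f x).
Proof. by rewrite /Ex exchange_big /= mulr_suml. Qed.

Lemma le_Ex f g : (forall w, f w <= g w) -> Ex f <= Ex g.
Proof. by move=> fg; rewrite ler_wpM2r ?invr_ge0 ?ler0n // ler_sum. Qed.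

Lemma Ex_cst a : (0 < #|Om|)%N -> Ex (fun=> a) = a.
Proof.
move=> Om0; rewrite /Ex (_ : \sum_w a = a * #|Om|%:R) ?mulfK ?pnatr_eq0 -?lt0n //.
by rewrite sumr_const mulr_natr.
Qed.

End Expectation.

(** * Success probability of a vote *)

Section Votes.
Local Open Scope ring_scope.
Variables (R : realType) (Om : finType) (X : Om -> nat -> nat) (B : nat).
Variables (E U : {fset edge}).
Hypothesis Om_gt0 : (0 < #|Om|)%N.

(** The distribution of the draws is only prescribed at these vertices, since the others may have
    terminated. *)
Definition centre v := has (spans E v) U.

Hypothesis B_gt0 : (0 < B)%N.
Hypothesis X1 : forall v th, centre v -> (th <= B)%N ->
  Ex (fun w => (X w v < th)%N%:R) = th%:R / B%:R :> R.
Hypothesis X2 : forall u v th, centre u -> centre v -> u != v -> (th <= B)%N ->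
  Ex (fun w => ((X w u < th) && (X w v < th))%N%:R) = (th%:R / B%:R) ^+ 2 :> R.

Implicit Types (e : edge) (u v : nat).

Lemma cands_centre e v : e \in U -> v \in cands E U e -> centre v.
Proof.
by move=> eU; rewrite in_cands => /andP[_ /scov_spans sp]; apply/hasP; exists e.
Qed.

Lemma scovU v e : e \in scov E U v -> e \in U.
Proof. by rewrite in_cov => /andP[]. Qed.

(* The union bound over the competitors drawing below a threshold, instead of
   conditioning on ranks, only needs pairwise independence and tolerates ties. *)
Lemma vote_chosen_ge (r : nat -> nat) e v th : v \in cands E U e ->
  let L := [fset f in scov E U v | (#|` cands E U f| <= #|` cands E U e|)%N] in
  (#|` scov E U v| <= 2 * #|` L|)%N ->
  (r v < th)%N%:R * (1 - \sum_(u <- cands E U e `\ v) (r u < th)%N%:R -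
    4 / 3 / #|` L|%:R * \sum_(f <- L) \sum_(u <- cands E U f `\ v) (r u < th)%N%:R)
  <= (vote E U r e v && chosen E U r v)%:R :> R.
Proof.
move=> vc L leL; case: ltnP => rv; last by rewrite mul0r ler0n.
rewrite mul1r.
(* [ok f] says that no competitor of [v] for [f] draws below the threshold; with [v] below it, this
   forces the vote of [f]. *)
pose ok f := ~~ has (fun u => r u < th)%N (cands E U f `\ v).
have sum_ge f : 1 - (ok f)%:R <= \sum_(u <- cands E U f `\ v) (r u < th)%N%:R :> R.
  rewrite /ok; case: hasP => [[u uc ru]|_]; last by rewrite subrr sumr_ge0.
  by rewrite (big_fsetD1 u) //= ru subr0 lerDl sumr_ge0.
have vote_ok f : v \in cands E U f -> ok f -> vote E U r f v.
  move=> vf /hasPn okf; rewrite /vote vf /=; apply/allP => u uf.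
  have [->|nuv] := eqVneq u v; first by rewrite /before ltnn eqxx leqnn.
  have := okf u; rewrite in_fsetD1 nuv uf => /(_ isT); rewrite -leqNgt => ru.
  by rewrite /before (leq_trans rv ru).
have vC : cand E U v by move: vc; rewrite in_cands => /andP[].
have L0 : (0 < #|` L|)%N.
  rewrite cardfs_gt0; apply/fset0Pn; exists e; rewrite in_sep leqnn andbT.
  by move: vc; rewrite in_cands => /andP[].
have L0' : 0 < #|` L|%:R :> R by rewrite ltr0n.
set s1 := \sum_(u <- _) _; set s2 := \sum_(f <- L) _.
have s2_0 : 0 <= s2 by rewrite sumr_ge0 // => f _; rewrite sumr_ge0.
have s1_0 : 0 <= s1 by rewrite sumr_ge0.
have c0 : 0 <= 4 / 3 / #|` L|%:R * s2.
  by rewrite mulr_ge0 // divr_ge0 ?ler0n // divr_ge0.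
have := sum_ge e; rewrite -/s1; case: (boolP (ok e)) => [oke _|_]; last first.
  rewrite subr0 => s11; apply: le_trans (ler0n _ _).
  by move: s11 c0; lra.
rewrite (vote_ok e vc oke) /=; case: (boolP (chosen E U r v)) => [_|].
  by apply: (@le_trans _ _ 1) => //; move: s1_0 c0; lra.
(* An unchosen [v] has fewer than an eighth of the possible votes, hence at most a quarter of [L].
   At least three quarters of [L] are then blocked, and the factor 4/3 makes the last subtracted
   term at least 1. *)
rewrite /chosen vC /= -ltnNge => few.
have s2_ge : #|` L|%:R - #|` votes E U r v|%:R <= s2.
  apply: (@le_trans _ _ (\sum_(f <- L) (1 - (ok f)%:R))); last first.
    by rewrite ler_sum // => f _; apply: sum_ge.
  rewrite sumrB -[1]/(1%:R) -!natr_sum -size_sum_fset lerD2l lerN2 ler_nat.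
  rewrite -card_sum_fset fsubset_leq_card //; apply/fsubsetP => f.
  rewrite in_sep in_votes => /andP[]; rewrite in_sep => /andP[fs _] okf.
  by rewrite fs vote_ok // in_cands vC.
have few' : #|` votes E U r v|%:R * 4 <= #|` L|%:R :> R.
  rewrite -natrM ler_nat mulnC; have := leq_trans (ltnW few) leL.
  by rewrite -[8%N]/(2 * 4)%N -mulnA leq_mul2l.
have : 1 <= 4 / 3 / #|` L|%:R * s2.
  rewrite mulrAC ler_pdivlMr // mul1r; move: s2_ge few'; lra.
by move: s1_0; lra.
Qed.

Lemma Ex_vote_chosen e v : v \in cands E U e ->
  (#|` scov E U v| <=
    2 * #|` [fset f in scov E U v | (#|` cands E U f| <= #|` cands E U e|)%N]|)%N ->
  (5 * #|` cands E U e| <= B)%N ->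
  (20 * #|` cands E U e|%:R)^-1 <=
    Ex (fun w => (vote E U (X w) e v && chosen E U (X w) v)%:R) :> R.
Proof.
move=> vc; set L := [fset f in _ | _]; set s := #|` cands E U e| => leL leB.
have eS : e \in scov E U v by move: vc; rewrite in_cands => /andP[].
have eU := scovU eS; have cv := cands_centre eU vc.
have s0 : (0 < s)%N by rewrite cardfs_gt0; apply/fset0Pn; exists v.
have s0' : 0 < s%:R :> R by rewrite ltr0n.
(* The probability q = th / B lies between 1 / (10 s) and 1 / (5 s). The losses s q^2 and 4/3 s q^2
   then leave at least q / 2, which is at least 1 / (20 s). *)
pose th := (B %/ (5 * s))%N.
have thB : (th <= B)%N by apply: leq_div.
pose q : R := th%:R / B%:R.
have B0 : 0 < B%:R :> R by rewrite ltr0n.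
have q0 : 0 <= q by rewrite divr_ge0 ?ler0n.
have q_le : q * (5 * s%:R) <= 1.
  rewrite mulrAC ler_pdivrMr // mul1r -!natrM ler_nat.
  exact: leq_divM.
have q_ge : 1 <= q * (10 * s%:R).
  rewrite mulrAC ler_pdivlMr // mul1r -!natrM ler_nat.
  have t1 : (0 < th)%N by rewrite divn_gt0 ?muln_gt0.
  have : (B < th.+1 * (5 * s))%N by rewrite ltn_ceil ?muln_gt0.
  rewrite mulSn; have : (1 * (5 * s) <= th * (5 * s))%N by rewrite leq_mul2r t1 orbT.
  by rewrite -[10%N]/(2 * 5)%N; nia.
have L0 : (0 < #|` L|)%N.
  by rewrite cardfs_gt0; apply/fset0Pn; exists e; rewrite in_sep leqnn andbT.
have L0' : 0 < #|` L|%:R :> R by rewrite ltr0n.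
have Ex2 f : f \in scov E U v ->
    \sum_(u <- cands E U f `\ v) Ex (fun w => ((X w v < th) && (X w u < th))%N%:R)
    <= #|` cands E U f|%:R * q ^+ 2.
  move=> fS; rewrite big_seq (eq_bigr (fun=> q ^+ 2)) => [|u]; last first.
    rewrite in_fsetD1 => /andP[nuv uc]; rewrite X2 1?eq_sym //.
    by apply: cands_centre uc; apply: scovU fS.
  rewrite -big_seq big_const_seq count_predT iter_addr_0 -[_ *+ size _]mulr_natl.
  by rewrite ler_wpM2r ?sqr_ge0 // ler_nat fsubset_leq_card // fsubD1set.
apply: le_trans (le_Ex (fun w => vote_chosen_ge (X w) th vc leL)).
pose b w u : R := (X w u < th)%N%:R.
pose c : R := 4 / 3 / #|` L|%:R.
have bb w u : b w v * b w u = ((X w v < th) && (X w u < th))%N%:R.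
  by rewrite /b; case: (X w v < th)%N; case: (X w u < th)%N; rewrite ?mul1r ?mul0r.
have -> : Ex (fun w => b w v * (1 - \sum_(u <- cands E U e `\ v) b w u -
      c * \sum_(f <- L) \sum_(u <- cands E U f `\ v) b w u)) = q
  - \sum_(u <- cands E U e `\ v) Ex (fun w => ((X w v < th) && (X w u < th))%N%:R)
  - c * \sum_(f <- L) \sum_(u <- cands E U f `\ v)
      Ex (fun w => ((X w v < th) && (X w u < th))%N%:R).
  have -> : \sum_(f <- L) \sum_(u <- cands E U f `\ v)
      Ex (fun w => ((X w v < th) && (X w u < th))%N%:R) =
      Ex (fun w => \sum_(f <- L) \sum_(u <- cands E U f `\ v)
        ((X w v < th) && (X w u < th))%N%:R) :> R.
    by rewrite Ex_sum; apply: eq_bigr => f _; rewrite Ex_sum.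
  rewrite /q -(X1 cv thB) -Ex_sum -ExZ -!ExN -!ExD; congr (_ / _).
  apply: eq_bigr => w _; rewrite -/(b w v) !mulrDr mulr1 !mulrN mulr_sumr; congr (_ - _ - _).
    by apply: eq_bigr => u _; rewrite bb.
  rewrite mulrCA mulr_sumr; congr (_ * _); apply: eq_bigr => f _.
  by rewrite mulr_sumr; apply: eq_bigr => u _; rewrite bb.
have S1 := Ex2 e eS.
have S2 : c * \sum_(f <- L) \sum_(u <- cands E U f `\ v)
      Ex (fun w => ((X w v < th) && (X w u < th))%N%:R) <= 4 / 3 * (s%:R * q ^+ 2).
  rewrite /c mulrAC ler_pdivrMr // -[leRHS]mulrA ler_wpM2l ?divr_ge0 //.
  rewrite [leRHS]mulrC size_sum_fset natr_sum mulr_suml big_seq [leRHS]big_seq ler_sum // => f.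
  rewrite in_sep => /andP[fS ls]; apply: le_trans (Ex2 f fS) _.
  by rewrite mul1r ler_wpM2r ?sqr_ge0 // ler_nat.
apply: (@le_trans _ _ (q / 2)).
  by rewrite -div1r ler_pdivrMr ?mulr_gt0 //; move: q_ge; lra.
move: S1 S2; rewrite -/s; nra.
Qed.

Lemma votes_covered (r : nat -> nat) e :
  \sum_(v <- cands E U e) (vote E U r e v && chosen E U r v)%:R <= (covered E U r e)%:R :> R.
Proof.
case: (boolP (has (fun v => vote E U r e v && chosen E U r v) (cands E U e))) => [|no].
  move=> /hasP[v vc /andP[vv cv]].
  have -> : covered E U r e.
    by apply/coveredP; exists v => //; move: vc; rewrite in_cands => /andP[].
  rewrite (big_fsetD1 v) //= vv cv big_seq big1 ?addr0 // => w.
  rewrite in_fsetD1 => /andP[nwv _]; case: (boolP (vote E U r e w)) => //= vw.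
  by rewrite (vote_inj vw vv) eqxx in nwv.
rewrite big_seq big1 ?ler0n // => v vc; apply/eqP; rewrite pnatr_eq0 eqb0.
by apply: contra no => h; apply/hasP; exists v.
Qed.

(** A good pair of edge and candidate succeeds with probability at least 1 / (20 |cands e|), which
    cancels the weight of [e]. Good pairs are at least half of all pairs, hence 40; closure of [T]
    keeps all edges of a candidate in the sum. *)
Lemma Ex_covered (T : {fset edge}) : T `<=` U ->
  (forall e v, e \in T -> v \in cands E U e -> scov E U v `<=` T) ->
  (forall e, e \in T -> (5 * #|` cands E U e| <= B)%N) ->
  (\sum_(e <- T) #|` cands E U e|)%N%:R / 40 <=
    Ex (fun w => \sum_(e <- T) #|` cands E U e|%:R * (covered E U (X w) e)%:R) :> R.
Proof.
move=> sT Tcl TB.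
(* A pair is good if at least half of the edges spanned by [v] have no more candidates than [e];
   [upper_half] applies at each [v]. *)
pose good v e := (#|` scov E U v| <=
    2 * #|` [fset f in scov E U v | (#|` cands E U f| <= #|` cands E U e|)%N]|)%N.
pose V := centres E.
have flip (P : nat -> edge -> bool) :
    (\sum_(e <- T) \sum_(v <- cands E U e) P v e =
     \sum_(v <- V) #|` [fset e in T | (v \in cands E U e) && P v e]|)%N.
  under [RHS]eq_bigr do rewrite card_sum_fset.
  rewrite [RHS]exchange_big /=; apply: eq_bigr => e _.
  rewrite -!card_sum_fset; congr #|` _|; apply/fsetP => v; rewrite !in_sep.
  apply/andP/andP => [[vc Pv]|[_ /andP[]]] //; rewrite vc; split=> //.
  by move: vc; rewrite in_cands => /andP[_ /scov_spans/spans_centres].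
have half : (\sum_(e <- T) #|` cands E U e| <=
    2 * \sum_(e <- T) \sum_(v <- cands E U e) good v e)%N.
  under eq_bigr do rewrite size_sum_fset.
  rewrite (flip (fun _ _ => true)) flip big_distrr /= leq_sum // => v _.
  set A := [fset e in T | _ && true]; set D := [fset e in T | _].
  have [->|/fset0Pn[e]] := eqVneq A fset0; first by rewrite cardfs0.
  rewrite in_sep andbT => /andP[eT vc].
  have sub := Tcl _ _ eT vc; have vC : cand E U v by move: vc; rewrite in_cands => /andP[].
  have -> : A = scov E U v.
    apply/fsetP => f; rewrite in_sep in_cands vC andbT /=.
    by apply: andb_idl => /(fsubsetP sub).
  apply: leq_trans (upper_half (scov E U v) (fun e => #|` cands E U e|)) _.
  rewrite leq_mul2l /= fsubset_leq_card //; apply/fsubsetP => f.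
  move=> fD; have /andP[fv gf] : (f \in scov E U v) && good v f by rewrite -in_sep.
  by rewrite in_sep in_cands vC fv (fsubsetP sub).
rewrite Ex_sum; apply: (@le_trans _ _
    (\sum_(e <- T) (\sum_(v <- cands E U e) good v e)%N%:R / 20)).
  rewrite -mulr_suml -natr_sum ler_pdivrMr // mulrAC ler_pdivlMr //.
  by rewrite -!natrM ler_nat; move: half; set a := (\sum_(e <- T) _)%N; set b := (\sum_(e <- T) _)%N; lia.
rewrite big_seq [leRHS]big_seq ler_sum // => e eT; rewrite ExZ.
have := le_Ex (fun w => votes_covered (X w) e); rewrite Ex_sum => le1.
apply: le_trans (ler_wpM2l (ler0n _ _) le1).
rewrite natr_sum mulr_suml mulr_sumr big_seq [leRHS]big_seq ler_sum // => v vc.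
have s0 : (0 < #|` cands E U e|)%N by rewrite cardfs_gt0; apply/fset0Pn; exists v.
have s0' : 0 < #|` cands E U e|%:R :> R by rewrite ltr0n.
case: (boolP (good v e)) => [gv|_]; last first.
  by rewrite mul0r mulr_ge0 ?ler0n // /Ex divr_ge0 ?ler0n // sumr_ge0.
have := Ex_vote_chosen vc gv (TB _ eT) => le2.
apply: le_trans (ler_wpM2l (ler0n _ _) le2).
by rewrite invfM mulrCA mulfV ?gt_eqF // mulr1 mul1r.
Qed.

End Votes.

(** * The weighted potential *)

Section Potential.
Variable E : {fset edge}.
Implicit Types (U : {fset edge}) (e : edge) (v k : nat).

Definition phi U k := \sum_(v <- centres E) #|` cov U (core E U k v) v|.

(** For [U] inside [E] the base exceeds every [phi U k], so these act as digits and the highest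
    nonzero one dominates. *)
Definition psi K U := \sum_(k < K) (#|` centres E| * #|` E|).+1 ^ k * phi U k.

Lemma phi_mono U U' k : U' `<=` U -> phi U' k <= phi U k.
Proof.
move=> sU; apply: leq_sum => v _; apply: fsubset_leq_card.
by apply: cov_sub => //; apply: core_monoU.
Qed.

Lemma psi_mono K U U' : U' `<=` U -> psi K U' <= psi K U.
Proof. by move=> sU; apply: leq_sum => k _; rewrite leq_mul2l phi_mono ?orbT. Qed.

Lemma phi_bound U k : U `<=` E -> phi U k <= #|` centres E| * #|` E|.
Proof.
move=> sU; rewrite size_sum_fset big_distrl /=; apply: leq_sum => v _; rewrite mul1n.
apply: fsubset_leq_card; apply: fsubset_trans sU.
by apply/fsubsetP => e; rewrite in_cov => /andP[].
Qed.

Lemma phi_eq0 U k : phi U k = 0 -> forall v, core E U k v = fset0.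
Proof.
move=> phi0 v; apply/eqP; apply: contraTT isT => c0.
have cc := core_neq0_cov c0; have /fset0Pn[e ec] := cc.
have vV : v \in centres E.
  move: ec; rewrite in_cov => /andP[_ /(spans_sub (core_subE _ _ _ _))].
  exact: spans_centres.
move: phi0; rewrite /phi (big_fsetD1 v) //= => /eqP.
by rewrite addn_eq0 cardfs_eq0 (negPf cc).
Qed.

Section Top.
Variables (U : {fset edge}) (k0 : nat).
Hypothesis top : forall k, k0 < k -> phi U k = 0.

Lemma lev_top v : lev E U v <= k0.+1.
Proof. by rewrite leqNgt lev_gt phi_eq0 ?eqxx // top. Qed.

Lemma lev_topE v : core E U k0 v != fset0 -> lev E U v = k0.+1.
Proof. by rewrite -lev_gt => lt; apply/eqP; rewrite eqn_leq lev_top. Qed.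

(** A centre with a nonempty core at [k0] has the maximal level and is a candidate. Conversely, a
    candidate spanning [e] must reach the level of [v0]. *)
Lemma cands_top e v0 : e \in cov U (core E U k0 v0) v0 ->
  cands E U e = [fset v in centres E | e \in cov U (core E U k0 v) v].
Proof.
have ne v : e \in cov U (core E U k0 v) v -> core E U k0 v != fset0.
  move=> ev; apply/negP => /eqP c0; move: ev; rewrite c0 in_cov /spans !in_fset0.
  by rewrite /= andbF.
have sp v : e \in cov U (core E U k0 v) v -> spans E v e.
  by rewrite in_cov => /andP[_]; apply: spans_sub; apply: core_subE.
move=> ev0; have eU : e \in U by move: ev0; rewrite in_cov => /andP[].
apply/fsetP => v; rewrite [LHS]in_cands [RHS]in_sep.
apply/andP/andP => [[cv ev]|[_ ev]].
  have spv := scov_spans ev; split; first exact: spans_centres spv.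
  have [_ le] := cand_lev_ge cv eU spv (sp _ ev0).
  have lv : lev E U v = k0.+1.
    by apply/eqP; rewrite eqn_leq lev_top -(lev_topE (ne _ ev0)).
  by move: ev; rewrite /scov /star lv.
have lv := lev_topE (ne _ ev); split; last by rewrite /scov /star lv.
rewrite /cand lv /=; apply/allP => f _; apply/implyP => _; apply/allP => w _.
exact: lev_top.
Qed.

Definition top_edges :=
  [fset e in U | has (fun v => e \in cov U (core E U k0 v) v) (centres E)].

Lemma top_edgesP e : e \in top_edges ->
  cands E U e = [fset v in centres E | e \in cov U (core E U k0 v) v].
Proof. by rewrite in_sep => /andP[_ /hasP[v _]]; apply: cands_top. Qed.

Lemma top_edges_closed e v : e \in top_edges -> v \in cands E U e ->
  scov E U v `<=` top_edges.
Proof.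
move=> eT; rewrite (top_edgesP eT) in_sep => /andP[vV ev].
have lv : lev E U v = k0.+1.
  apply: lev_topE; apply/negP => /eqP c0; move: ev; rewrite c0 in_cov /spans !in_fset0.
  by rewrite /= andbF.
apply/fsubsetP => f; rewrite /scov /star lv /= => fv; rewrite in_sep; apply/andP; split.
  by move: fv; rewrite in_cov => /andP[].
by apply/hasP; exists v.
Qed.

Lemma phi_top (P : pred edge) :
  \sum_(v <- centres E) #|` [fset e in cov U (core E U k0 v) v | P e]| =
  \sum_(e <- top_edges) #|` cands E U e| * P e.
Proof.
have covE v : #|` [fset e in cov U (core E U k0 v) v | P e]| =
    \sum_(e <- top_edges) (e \in cov U (core E U k0 v) v) && P e.
  rewrite -card_sum_fset; case: (boolP (v \in centres E)) => [vV|vV]; last first.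
    congr #|` _|; apply/fsetP => e.
    have /negPf ne : e \notin cov U (core E U k0 v) v.
      apply: contra vV; rewrite in_cov => /andP[_ /(spans_sub (core_subE _ _ _ _))].
      exact: spans_centres.
    by rewrite [LHS]in_sep [RHS]in_sep ne andbF.
  congr #|` _|; apply/fsetP => e; rewrite [LHS]in_sep [RHS]in_sep.
  apply/andP/and3P => [[ev Pe]|[_ ev Pe]]; split => //.
  rewrite in_sep; apply/andP; split; first by move: ev; rewrite in_cov => /andP[].
  by apply/hasP; exists v.
under eq_bigr do rewrite covE.
rewrite exchange_big /= big_seq [RHS]big_seq; apply: eq_bigr => e eT.
rewrite (top_edgesP eT) card_sum_fset big_distrl /=; apply: eq_bigr => v _.
by case: (_ \in _); rewrite ?mul1n ?mul0n.
Qed.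

Lemma phi_topE : phi U k0 = \sum_(e <- top_edges) #|` cands E U e|.
Proof.
have := phi_top xpredT; under [RHS]eq_bigr do rewrite muln1; move=> <-.
apply: eq_bigr => v _; congr #|` _|; apply/fsetP => e.
by rewrite [RHS]in_sep andbT.
Qed.

Lemma phi_remain r :
  phi (remain E U r) k0 + \sum_(e <- top_edges) #|` cands E U e| * covered E U r e
  <= phi U k0.
Proof.
rewrite phi_topE; set U' := remain E U r.
apply: leq_trans (_ : \sum_(e <- top_edges) #|` cands E U e| * (e \in U') +
    \sum_(e <- top_edges) #|` cands E U e| * covered E U r e <= _); last first.
  rewrite -big_split /= leq_sum // => e _; rewrite -mulnDr -[leqRHS]muln1 leq_mul2l.
  apply/orP; right; rewrite in_remain; case: (covered _ _ _ _) => /=; last by case: (_ && _).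
  by rewrite orbT andbF.
rewrite leq_add2r -phi_top; apply: leq_sum => v _; apply: fsubset_leq_card.
apply/fsubsetP => e ev; rewrite in_sep; apply/andP; split; last first.
  by move: ev; rewrite in_cov => /andP[].
apply: (fsubsetP (cov_sub _ (remain_sub E U r) (core_monoU _ _ _ (remain_sub E U r)))).
exact: ev.
Qed.

End Top.

Lemma psi_lt K U : U `<=` E -> psi K U < (#|` centres E| * #|` E|).+1 ^ K.
Proof.
move=> sU; rewrite /psi; elim: K => [|K IH]; first by rewrite big_ord0.
rewrite big_ord_recr /= -addSn expnSr mulnS; apply: leq_add IH _.
by rewrite leq_mul2l phi_bound ?orbT.
Qed.

(** By [psi_lt] the lower levels add up to less than one unit of level [k0]. *)
Lemma psi_top K U k0 : U `<=` E -> k0 < K -> 0 < phi U k0 ->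
  (forall k, k0 < k -> phi U k = 0) ->
  psi K U <= 2 * ((#|` centres E| * #|` E|).+1 ^ k0 * phi U k0).
Proof.
move=> sU ltK phi0 top; rewrite /psi; set M := _.+1.
rewrite -(big_mkord xpredT (fun k => M ^ k * phi U k)) (@big_cat_nat _ _ _ k0.+1) //=.
rewrite [X in _ + X]big_nat_cond [X in _ + X]big1 ?addn0; last first.
  by move=> k /andP[/andP[/top -> _] _]; rewrite muln0.
rewrite big_nat_recr //= big_mkord mul2n -addnn leq_add2r.
by apply: leq_trans (ltnW (psi_lt k0 sU)) _; rewrite leq_pmulr.
Qed.

Lemma exists_top K U : (forall k, K <= k -> phi U k = 0) -> 0 < psi K U ->
  exists k0, [/\ k0 < K, 0 < phi U k0 & forall k, k0 < k -> phi U k = 0].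
Proof.
move=> big0 psi0.
have ex : exists k, 0 < phi U k.
  have : has (fun k => 0 < phi U k) (iota 0 K).
    apply: contraTT psi0 => /hasPn no; rewrite -eqn0Ngt; apply/eqP/big1 => k _.
    by have := no k; rewrite mem_iota /= => /(_ (ltn_ord k)); rewrite -eqn0Ngt => /eqP->; rewrite muln0.
  by case/hasP => k _; exists k.
have ub k : 0 < phi U k -> k <= K.
  by move=> p; rewrite leqNgt; apply/negP => /ltnW/big0 p0; rewrite p0 in p.
case: (ex_maxnP ex ub) => k0 p0 max0; exists k0; split => //.
  by rewrite ltnNge; apply/negP => /big0 p; rewrite p in p0.
by move=> k lt; apply/eqP; rewrite eqn0Ngt; apply/negP => /max0; rewrite leqNgt lt.
Qed.

(** When all cores are empty, every uncovered edge adds itself. *)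
Lemma psi0_remain K U r : (forall k, K <= k -> phi U k = 0) -> psi K U = 0 ->
  remain E U r = fset0.
Proof.
move=> big0 psi0; have p0 : phi U 0 = 0.
  apply/eqP; rewrite eqn0Ngt; apply/negP => p.
  case: (posnP K) => [K0|K0]; first by rewrite big0 ?K0 in p.
  move: psi0; rewrite /psi (bigD1 (Ordinal K0)) //= => /eqP.
  by rewrite addn_eq0 expn0 mul1n => /andP[/eqP q _]; rewrite q in p.
apply/fsetP => e; rewrite in_remain in_fset0; apply/negP => /andP[_].
rewrite negb_or => /andP[/allPn[w _]].
by rewrite -lt0n lev_gt phi_eq0 ?eqxx.
Qed.

Section Decrease.
Local Open Scope ring_scope.
Variables (R : realType) (Om : finType) (X : Om -> nat -> nat) (B K : nat).
Variables (U : {fset edge}).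
Hypotheses (Om_gt0 : (0 < #|Om|)%N) (B_gt0 : (0 < B)%N).
Hypothesis X1 : forall v th, centre E U v -> (th <= B)%N ->
  Ex (fun w => (X w v < th)%N%:R) = th%:R / B%:R :> R.
Hypothesis X2 : forall u v th, centre E U u -> centre E U v -> u != v -> (th <= B)%N ->
  Ex (fun w => ((X w u < th) && (X w v < th))%N%:R) = (th%:R / B%:R) ^+ 2 :> R.
Hypotheses (sU : U `<=` E) (K_big : forall k, (K <= k)%N -> phi U k = 0%N).
Hypothesis B_big : (5 * #|` centres E| <= B)%N.

(** The rate 1 / 80 is the expected drop 1 / 40 of the top level, halved because that level carries
    at least half of the potential. *)
Lemma Ex_psi : Ex (fun w => (psi K (remain E U (X w)))%:R) <=
  (1 - 1 / 80) * (psi K U)%:R :> R.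
Proof.
have [p0|p0] := posnP (psi K U).
  rewrite p0 mulr0 -[leRHS](Ex_cst 0 Om_gt0); apply: le_Ex => w.
  by rewrite lern0 -leqn0 -p0 psi_mono // remain_sub.
have [k0 [ltK phi0 top]] := exists_top K_big p0.
have le2 := psi_top sU ltK phi0 top; set M := (_ * _).+1 in le2.
have sT : top_edges U k0 `<=` U by apply/fsubsetP => e; rewrite in_sep => /andP[].
have le3 := Ex_covered Om_gt0 B_gt0 X1 X2 sT (@top_edges_closed U k0 top).
have {le3} : (phi U k0)%:R / 40 <= Ex (fun w =>
    \sum_(e <- top_edges U k0) #|` cands E U e|%:R * (covered E U (X w) e)%:R) :> R.
  rewrite (phi_topE top); apply: le3 => e eT; apply: leq_trans B_big.
  rewrite leq_mul2l /= fsubset_leq_card // (top_edgesP top eT).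
  by apply/fsubsetP => v; rewrite in_sep => /andP[].
set G := Ex _ => le3.
have dec w : (psi K (remain E U (X w)))%:R <= (psi K U)%:R - (M ^ k0)%N%:R *
    \sum_(e <- top_edges U k0) #|` cands E U e|%:R * (covered E U (X w) e)%:R :> R.
  have -> : \sum_(e <- top_edges U k0) #|` cands E U e|%:R * (covered E U (X w) e)%:R =
      (\sum_(e <- top_edges U k0) #|` cands E U e| * covered E U (X w) e)%N%:R :> R.
    by rewrite natr_sum; apply: eq_bigr => e _; rewrite natrM.
  rewrite lerBrDr -natrM -natrD ler_nat /psi -/M.
  rewrite (bigD1 (Ordinal ltK)) //= [leqRHS](bigD1 (Ordinal ltK)) //=.
  rewrite addnAC leq_add //; last first.
    by apply: leq_sum => k _; rewrite leq_mul2l phi_mono ?orbT // remain_sub.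
  by rewrite -mulnDr leq_mul2l phi_remain ?orbT.
apply: le_trans (le_Ex dec) _; rewrite ExD Ex_cst // ExN ExZ -/G.
have le4 : (M ^ k0)%N%:R * ((phi U k0)%:R / 40) <= (M ^ k0)%N%:R * G :> R.
  by rewrite ler_wpM2l ?ler0n.
have le2' : (psi K U)%:R <= 2 * ((M ^ k0)%N%:R * (phi U k0)%:R) :> R.
  by rewrite -!natrM ler_nat.
move: le4 le2'; move: (_ * G) => g; rewrite mulrA; move: (_ * (phi U k0)%:R) => y.
by move: (psi K U)%:R => z; lra.
Qed.

End Decrease.
End Potential.

(** * The message-passing algorithm *)

Definition touches (z : nat) (e : edge) := (e.1 == z) || (e.2 == z).

Definition at_ (A : {fset edge}) (z : nat) := [fset e in A | touches z e].

(* A fact is a tagged pair: (0, e) says that e is an edge, (1, e) that e is an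
   uncovered edge, and (2, (z, x)) that the vertex z drew x in this phase. *)
Local Notation fact := (nat * edge)%type.

Definition told (k : nat) (F : {fset fact}) : {fset edge} :=
  [fset f.2 | f in [fset g in F | g.1 == k]].

(** The maximum reads off the draw, which is unique when the facts come from one phase; it is 0 for
    an unheard vertex. *)
Definition told_draw (F : {fset fact}) (z : nat) : nat :=
  \max_(f <- F | (f.1 == 2) && (f.2.1 == z)) f.2.2.

Definition own_facts (EA UA : {fset edge}) (z x : nat) : {fset fact} :=
  [fset (0, e) | e in EA] `|` [fset (1, e) | e in UA] `|` [fset (2, (z, x))].

(** [nE], [nU] and [nH] hold incident edges: all of them, the uncovered ones, and those this vertex
    put in the spanner. [npos] is the round within the phase and [nF] the facts heard in it. *)
Record node := Node {
  nid : nat;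
  nE : {fset edge};
  nU : {fset edge};
  nH : {fset edge};
  nphase : nat;
  npos : nat;
  nF : {fset fact};
  ndone : bool
}.

(* Whether an edge gets covered depends on the centres that an endpoint reaches
   in 2 steps, on those 4 steps further, and on the neighbours of the latter. *)
Definition period := 7.

Definition node_init (i : nat) (out inn : seq nat) : node :=
  let A := [fset (i, j) | j in out] `|` [fset (j, i) | j in inn] in
  Node i A A fset0 0 0 fset0 false.

(** Only the draw of the first round of a phase enters the flooding. *)
Definition known (s : node) (x : nat) : {fset fact} :=
  if npos s == 0 then own_facts (nE s) (nU s) (nid s) x else nF s.

Definition neighbours (s : node) : seq nat :=
  [seq h.1 | h <- nE s] ++ [seq h.2 | h <- nE s].

Definition gather (s : node) (x : nat) (ib : nat -> option {fset fact}) :=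
  known s x `|` \bigcup_(j <- neighbours s) odflt fset0 (ib j).

(** A vertex still matters while it is an endpoint or a possible centre of an uncovered edge;
    otherwise it terminates at the end of the phase. *)
Definition concerns (E U : {fset edge}) (z : nat) :=
  has (fun e => touches z e || spans E z e) U.

Definition finish (s : node) (F : {fset fact}) : node :=
  let U' := remain (told 0 F) (told 1 F) (told_draw F) in
  Node (nid s) (nE s) (at_ U' (nid s))
    (nH s `|` added (told 0 F) (told 1 F) (told_draw F) (nid s))
    (nphase s).+1 0 fset0 (~~ concerns (told 0 F) U' (nid s)).

Definition node_recv (s : node) (x : nat) (ib : nat -> option {fset fact}) :=
  let F := gather s x ib in
  if (npos s).+1 < period then
    Node (nid s) (nE s) (nU s) (nH s) (nphase s) (npos s).+1 F false
  else finish s F.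

(* The number n of vertices is unknown, but from phase log2 (5 n) on the range
   2 ^ phase is large enough for ties to be harmless. *)
Definition spanner_algorithm : local_algorithm :=
  @LocalAlgorithm node {fset fact} node_init
    (fun s => if npos s == 0 then 2 ^ nphase s else 0)
    (fun s x _ => known s x)
    node_recv
    (fun s => if ndone s then Some (fun e => e \in nH s) else None).

Lemma in_at A z e : (e \in at_ A z) = (e \in A) && touches z e.
Proof. exact: in_sep. Qed.

Lemma in_told k F e : (e \in told k F) = ((k, e) \in F).
Proof.
apply/imfsetP/idP => [[[k' f]]|h].
  by rewrite in_sep /= => /andP[h /eqP <-] ->.
by exists (k, e) => //; rewrite in_sep h /=.
Qed.

Lemma in_own_facts EA UA z x k e : ((k, e) \in own_facts EA UA z x) =
  [|| (k == 0) && (e \in EA), (k == 1) && (e \in UA) | (k == 2) && (e == (z, x))].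
Proof.
rewrite !in_fsetU in_fset1 xpair_eqE -orbA.
have imf k' (A : {fset edge}) : ((k, e) \in [fset (k', f) | f in A]) = (k == k') && (e \in A).
  apply/imfsetP/andP => [[f fA [-> ->]]|[/eqP -> eA]]; first by rewrite eqxx.
  by exists e.
by rewrite !imf.
Qed.

Lemma told_drawE F z x : (2, (z, x)) \in F ->
  (forall y, (2, (z, y)) \in F -> y = x) -> told_draw F z = x.
Proof.
move=> xF uniq_x; apply/eqP; rewrite eqn_leq; apply/andP; split.
  apply/bigmax_leqP_seq => -[k [a b]] /= fF /andP[/eqP k2 /eqP az].
  by rewrite k2 az in fF; rewrite (uniq_x _ fF).
by rewrite /told_draw (big_rem (2, (z, x))) //= eqxx leq_maxl.
Qed.

Lemma concernsP E U z :
  reflect (exists2 e, e \in U & touches z e || spans E z e) (concerns E U z).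
Proof. exact: hasP. Qed.

Lemma concerns_sub E U U' z : U' `<=` U -> concerns E U' z -> concerns E U z.
Proof. by move=> /fsubsetP sU /concernsP[e /sU eU h]; apply/concernsP; exists e. Qed.

Lemma star_touches E U v h : h \in star E U v -> touches v h.
Proof.
move=> hs; have := denseP _ _ _ _ (core_dense E U (lev E U v).-1 v) _ hs => le.
have /sdeg_gt0[e [_ _ [] ->]] := leq_trans (expn_gt0 2 _) le; rewrite /touches /= eqxx //.
by rewrite orbT.
Qed.

Lemma added_touches E U r v h : h \in added E U r v -> touches v h.
Proof.
rewrite in_added => /orP[/andP[_ /star_touches]//|/and3P[_ h1 _]].
by rewrite /touches h1.
Qed.

Lemma added_concerns E U r v h : h \in added E U r v -> concerns E U v.
Proof.
rewrite in_added => /orP[/andP[/andP[/andP[l0 _] _] _]|/and3P[hU h1 _]].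
  have /fset0Pn[e ev] := scov_neq0 l0; apply/concernsP; exists e.
    by move: ev; rewrite in_cov => /andP[].
  by rewrite (scov_spans ev) orbT.
by apply/concernsP; exists h; rewrite // /touches h1.
Qed.

(** * Agreement of the distributed run with the global phases *)

Section Simulation.
Variable G : network.
Implicit Types (U H : {fset edge}) (c : config spanner_algorithm G) (v w : vertex G).

Definition id_edges : {fset edge} := [fset (vid e.1, vid e.2) | e in edges G].

Local Notation E := id_edges.

Lemma id_edgesP e :
  reflect (exists u v, (u, v) \in edges G /\ e = (vid u, vid v)) (e \in E).
Proof.
apply: (iffP (imfsetP _ _ _ _)) => [[[u v] /= h ->]|[u [v [h ->]]]]; first by exists u, v.
by exists (u, v).
Qed.

Lemma mem_id_edges u v : ((vid u, vid v) \in E) = ((u, v) \in edges G).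
Proof.
apply/id_edgesP/idP => [[u' [v' [h [/vid_inj -> /vid_inj ->]]]] //|h].
by exists u, v.
Qed.

Lemma id_touches e z : e \in E -> touches z e -> exists v, vid v = z.
Proof.
by move=> /id_edgesP[u [v [_ ->]]] /orP[]/eqP <- /=; [exists u | exists v].
Qed.

Lemma id_spans e z : spans E z e -> exists v, vid v = z.
Proof. by move=> /andP[h _]; apply: (id_touches h); rewrite /touches eqxx orbT. Qed.

(** * Flooding through active vertices *)

Section Flooding.
Variables (alive : pred nat) (base : nat -> {fset fact}).

Definition aadj (x y : nat) :=
  [&& alive x, alive y & ((x, y) \in E) || ((y, x) \in E)].

Fixpoint reach (n x z : nat) : Prop :=
  if n is n'.+1 then reach n' x z \/ exists2 y, aadj x y & reach n' y z else x = z.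

(** Soundness with respect to all active vertices, and completeness within [n] hops along active
    ones. *)
Definition informed (n x : nat) (F : {fset fact}) : Prop :=
  (forall f, f \in F -> exists2 z, alive z & f \in base z) /\
  (forall z, reach n x z -> base z `<=` F).

Lemma reach_trans n x y z : reach n x y -> aadj y z -> reach n.+1 x z.
Proof.
elim: n x => [|n IH] x /=; first by move=> -> h; right; exists z.
move=> [r h|[x' xx' r h]]; first by left; apply: IH h.
by right; exists x' => //; apply: IH h.
Qed.

Lemma reach_leq m n x z : m <= n -> reach m x z -> reach n x z.
Proof. by move=> /subnK <-; elim: (n - m) => //= k IH /IH; left. Qed.

Lemma informed_step n x (F : {fset fact}) (Fs : nat -> {fset fact}) (ys : seq nat) :
  informed n x F ->
  (forall y, y \in ys -> Fs y = fset0 \/ informed n y (Fs y)) ->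
  (forall y, aadj x y -> y \in ys /\ informed n y (Fs y)) ->
  informed n.+1 x (F `|` \bigcup_(y <- ys) Fs y).
Proof.
move=> [sound compl] sub sup; split=> [f|z /= [r|[y xy r]]].
- rewrite in_fsetU => /orP[/sound //|/bigfcupP[y /andP[ys_y _] fy]].
  have [F0|[so _]] := sub y ys_y; last exact: so.
  by move: fy; rewrite F0 in_fset0.
- by apply: fsubset_trans (compl _ r) _; apply: fsubsetUl.
- have [ys_y [_ co]] := sup _ xy.
  apply: fsubset_trans (co _ r) _; apply: fsubset_trans (fsubsetUr _ _).
  exact: bigfcup_sup.
Qed.

End Flooding.

(** Termination is decided at the end of a phase, so in phase 0 every vertex is active, even an
    isolated one. *)
Definition active (i : nat) U (z : nat) : bool := (i == 0) || concerns E U z.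

Definition base U (r : nat -> nat) (z : nat) : {fset fact} :=
  own_facts (at_ E z) (at_ U z) z (r z).

Definition marks_spanner H c : Prop :=
  (forall v h, h \in nH (c v) -> h \in H /\ touches (vid v) h) /\
  (forall h, h \in H -> exists v, h \in nH (c v)).

Definition awake (i : nat) U (p : nat) c v : Prop :=
  [/\ nid (c v) = vid v, nE (c v) = at_ E (vid v), nU (c v) = at_ U (vid v) &
   [/\ nphase (c v) = i, npos (c v) = p & ndone (c v) = false]].

Definition phase_start (i : nat) U H c : Prop :=
  [/\ U `<=` E, H `<=` E, marks_spanner H c &
      forall v, if active i U (vid v) then awake i U 0 c v else ndone (c v)].

Definition in_phase (i : nat) U H (r : nat -> nat) (p : nat) c : Prop :=
  [/\ U `<=` E, H `<=` E, marks_spanner H c &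
      forall v, if active i U (vid v)
                then awake i U p c v /\
                     informed (active i U) (base U r) p (vid v) (nF (c v))
                else ndone (c v)].

Lemma haltedE c v : halted c v = ndone (c v).
Proof. by rewrite /halted /=; case: (ndone _). Qed.

Lemma phase_start0 : phase_start 0 E fset0 (@init_config spanner_algorithm G).
Proof.
have nE0 v e : (e \in nE (@init_config spanner_algorithm G v)) = (e \in at_ E (vid v)).
  rewrite /= in_at in_fsetU; apply/orP/andP.
    case=> /imfsetP[j /=]; rewrite mem_sort => /imageP[w]; rewrite inE => h -> ->.
      by rewrite mem_id_edges h /touches /= eqxx.
    by rewrite mem_id_edges h /touches /= eqxx orbT.
  case=> /id_edgesP[u [w [h ->]]] /orP[]/eqP /= /vid_inj eqv; [left|right].
    apply/imfsetP; exists (vid w); rewrite /= ?eqv // mem_sort.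
    by apply/imageP; exists w; rewrite // inE -eqv.
  apply/imfsetP; exists (vid u); rewrite /= ?eqv // mem_sort.
  by apply/imageP; exists u; rewrite // inE -eqv.
split; [exact: fsubset_refl | exact: fsub0set | by split => [v|] h; rewrite in_fset0 |].
move=> v; rewrite /active /=; split; first by [].
- by apply/fsetP => e; apply: nE0.
- by apply/fsetP => e; rewrite -nE0.
- by [].
Qed.

Definition draw_fun c (d : draws c) (z : nat) : nat :=
  if [pick v | vid v == z] is Some v then d v else 0.

Lemma draw_funE c (d : draws c) v : draw_fun d (vid v) = d v.
Proof.
rewrite /draw_fun; case: pickP => [w /eqP/vid_inj -> //|/(_ v)].
by rewrite eqxx.
Qed.

(** * What a vertex learns during one phase *)

Section OnePhase.
Variables (i : nat) (U : {fset edge}) (r : nat -> nat).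
Hypothesis sU : U `<=` E.

Local Notation alive := (active i U).

Lemma alive_near e z : e \in U -> touches z e || spans E z e -> alive z.
Proof. by move=> eU h; apply/orP; right; apply/concernsP; exists e. Qed.

Lemma aadj_sym x y : aadj alive x y -> aadj alive y x.
Proof. by case/and3P => ax ay h; rewrite /aadj ax ay orbC. Qed.

(** Endpoints and centres of an uncovered edge are all active, so the relays between them have not
    terminated. *)
Lemma aadj_span e z : e \in U -> spans E z e -> aadj alive e.1 z.
Proof.
move=> eU sp; apply/and3P; split; last by have /andP[-> _] := sp.
  by apply: (alive_near eU); rewrite /touches eqxx.
by apply: (alive_near eU); rewrite sp orbT.
Qed.

Lemma aadj_span2 e z : e \in U -> spans E z e -> aadj alive e.2 z.
Proof.
move=> eU sp; apply/and3P; split; last by have /andP[_ ->] := sp; rewrite orbT.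
  by apply: (alive_near eU); rewrite /touches eqxx orbT.
by apply: (alive_near eU); rewrite sp orbT.
Qed.

Section Reading.
Variables (x : nat) (F : {fset fact}).
Hypothesis Fx : informed alive (base U r) period x F.

Lemma told0_sub : told 0 F `<=` E.
Proof.
apply/fsubsetP => e; rewrite in_told => /(proj1 Fx)[z _].
by rewrite in_own_facts /= orbF in_at => /andP[].
Qed.

Lemma told1_sub : told 1 F `<=` U.
Proof.
apply/fsubsetP => e; rewrite in_told => /(proj1 Fx)[z _].
by rewrite in_own_facts /= orbF in_at => /andP[].
Qed.

Lemma told0_near e z : reach alive period x z -> e \in E -> touches z e -> e \in told 0 F.
Proof.
move=> re eE te; rewrite in_told; apply: (fsubsetP (proj2 Fx _ re)).
by rewrite in_own_facts in_at eE te.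
Qed.

Lemma told1_near e z : reach alive period x z -> e \in U -> touches z e -> e \in told 1 F.
Proof.
move=> re eU te; rewrite in_told; apply: (fsubsetP (proj2 Fx _ re)).
by rewrite in_own_facts /= in_at eU te.
Qed.

Lemma told_draw_near z : reach alive period x z -> told_draw F z = r z.
Proof.
move=> re; apply: told_drawE.
  apply: (fsubsetP (proj2 Fx _ re)); by rewrite in_own_facts /= eqxx.
move=> y /(proj1 Fx)[z' _]; rewrite in_own_facts /= xpair_eqE => /andP[/eqP -> /eqP ->].
by [].
Qed.

(** Centres of a common uncovered edge are two hops apart through its tail, hence the doubling; the
    strict inequality leaves one hop for the facts of the tail itself. *)
Lemma sees_reach n d z : reach alive d x z -> d + n.*2 < period ->
  sees E U (told 0 F) (told 1 F) r (told_draw F) n z.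
Proof.
elim: n d z => [|n IH] d z re lt /=.
  move=> e eU sp; have re' : reach alive period x z.
    by apply: reach_leq re; apply: ltnW; rewrite -[d]addn0.
  have adj := aadj_sym (aadj_span eU sp).
  have re1 : reach alive period x e.1.
    by apply: reach_leq (reach_trans re adj); rewrite -[d]addn0.
  have [h1 h2] := andP sp; split.
  - by apply: (told1_near re1 eU); rewrite /touches eqxx.
  - by apply/andP; split; apply: (told0_near re') => //; rewrite /touches /= eqxx ?orbT.
  - exact: told_draw_near.
split; first by apply: IH re _; move: lt; rewrite doubleS; lia.
move=> e eU sp w spw; apply: (IH d.+2); last by move: lt; rewrite doubleS; lia.
apply: reach_trans (aadj_span eU spw).
exact: reach_trans (aadj_sym (aadj_span eU sp)).
Qed.

Lemma reach_mid e (w : nat) : e \in U -> touches x e || spans E x e -> spans E w e ->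
  reach alive 2 x w.
Proof.
move=> eU /orP[/orP[]/eqP ex|sp] spw.
- by apply: (@reach_leq _ 1) => //=; right; exists w => //; rewrite -ex; apply: aadj_span.
- by apply: (@reach_leq _ 1) => //=; right; exists w => //; rewrite -ex; apply: aadj_span2.
- apply: reach_trans (aadj_span eU spw) => /=; right; exists e.1 => //.
  exact: aadj_sym (aadj_span eU sp).
Qed.

Lemma told1_concern e : e \in U -> touches x e || spans E x e -> e \in told 1 F.
Proof.
move=> eU /orP[te|sp]; first by apply: told1_near te => //; apply: (@reach_leq _ 0).
apply: (@told1_near _ e.1) => //; last by rewrite /touches eqxx.
apply: (@reach_leq _ 1) => //=; right; exists e.1 => //.
exact: aadj_sym (aadj_span eU sp).
Qed.

Let U' := remain (told 0 F) (told 1 F) (told_draw F).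

(** The tight case for [period]: 2 hops to a centre of [e] and 4 for the distance 2 seen from there,
    with 6 < 7. *)
Lemma remain_concern e : e \in U -> touches x e || spans E x e ->
  (e \in U') = (e \in remain E U r).
Proof.
move=> eU h; apply: (remain_loc told0_sub told1_sub); first exact: told1_concern.
by move=> w spw; apply: (@sees_reach 2 2) => //; apply: (reach_mid eU h spw).
Qed.

Lemma remain_at : at_ U' x = at_ (remain E U r) x.
Proof.
apply/fsetP => e; rewrite [LHS]in_at [RHS]in_at.
apply: andb_id2r => te; apply/idP/idP => h.
  have eU : e \in U by apply: (fsubsetP told1_sub); apply: (fsubsetP (remain_sub _ _ _) _ h).
  by rewrite -(remain_concern eU) ?te.
have eU : e \in U by apply: (fsubsetP (remain_sub _ _ _) _ h).
by rewrite (remain_concern eU) ?te.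
Qed.

Lemma remain_concerns : concerns (told 0 F) U' x = concerns E (remain E U r) x.
Proof.
apply/concernsP/concernsP => -[e eR h].
  have h' : touches x e || spans E x e.
    by case/orP: h => [->//|/(spans_sub told0_sub) ->]; rewrite orbT.
  have eU : e \in U.
    by move: eR; rewrite in_remain => /andP[/(fsubsetP told1_sub)].
  by exists e; [rewrite -(remain_concern eU h') | exact: h'].
have eU : e \in U by move: eR; rewrite in_remain => /andP[].
exists e; first by rewrite remain_concern.
case/orP: h => [->//|sp]; apply/orP; right.
by have [] := @sees_reach 0 0 x (erefl x) isT e eU sp.
Qed.

Lemma added_exact : added (told 0 F) (told 1 F) (told_draw F) x = added E U r x.
Proof.
apply: (added_loc told0_sub told1_sub); first exact: (@sees_reach 2 0).
move=> e eU ex; have te : touches x e by rewrite /touches ex eqxx.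
split; first by apply: told1_concern; rewrite ?te.
move=> w spw; apply: (@sees_reach 0 2) => //; apply: (reach_mid eU) spw.
by rewrite te.
Qed.

End Reading.

Lemma gather_informed p c (d : draws c) v :
  (forall w, if alive (vid w)
             then awake i U p c w /\ informed alive (base U r) p (vid w) (known (c w) (d w))
             else ndone (c w)) ->
  alive (vid v) ->
  informed alive (base U r) p.+1 (vid v) (gather (c v) (d v) (inbox d v)).
Proof.
move=> inv av; have := inv v; rewrite av => -[[_ nEv _ _] iv].
have box w : link v w -> alive (vid w) -> inbox d v (vid w) = Some (known (c w) (d w)).
  move=> lvw aw; rewrite /inbox; case: pickP => [w' /and3P[_ /eqP/vid_inj -> _]|/(_ w)] //.
  have := inv w; rewrite aw => -[[_ _ _ [_ _ dw]] _].
  by rewrite lvw eqxx haltedE dw.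
apply: informed_step => // [y _|y].
  rewrite /inbox; case: pickP => [w /and3P[_ /eqP <- nh]|_]; [right|by left].
  have := inv w; rewrite haltedE in nh; case: ifP => [_ []//|_ dw].
  by rewrite dw in nh.
case/and3P => _ ay h; have [w wy] : exists w, vid w = y.
  by case/orP: h => h; apply: (id_touches h); rewrite /touches /= eqxx ?orbT.
have lvw : link v w by rewrite /link -!mem_id_edges wy.
rewrite -wy box // ?wy //; split; last by have := inv w; rewrite wy ay => -[].
rewrite /neighbours nEv mem_cat; case/orP: h => h; apply/orP; [right|left].
  by apply/mapP; exists (vid v, y) => //; rewrite in_at h /touches /= eqxx.
by apply/mapP; exists (y, vid v) => //; rewrite in_at h /touches /= eqxx orbT.
Qed.

End OnePhase.

Lemma step_halted c (d : draws c) v : ndone (c v) -> step d v = c v.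
Proof. by move=> dv; rewrite /step haltedE dv. Qed.

Lemma step_active c (d : draws c) v : ndone (c v) = false ->
  step d v = node_recv (c v) (d v) (inbox d v).
Proof. by move=> dv; rewrite /step haltedE dv. Qed.

Lemma node_recv_mid s x ib p : npos s = p -> p.+1 < period ->
  node_recv s x ib =
  Node (nid s) (nE s) (nU s) (nH s) (nphase s) p.+1 (gather s x ib) false.
Proof. by rewrite /node_recv => -> ->. Qed.

Lemma node_recv_end s x ib p : npos s = p -> p.+1 = period ->
  node_recv s x ib = finish s (gather s x ib).
Proof. by rewrite /node_recv => -> ->; rewrite ltnn. Qed.

Lemma step_mid i U H r p c (d : draws c) : p.+1 < period ->
  U `<=` E -> H `<=` E -> marks_spanner H c ->
  (forall w, if active i U (vid w)
             then awake i U p c w /\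
                  informed (active i U) (base U r) p (vid w) (known (c w) (d w))
             else ndone (c w)) ->
  in_phase i U H r p.+1 (step d).
Proof.
move=> ltp sU sH [mark1 mark2] inv.
have nH_step v : nH (step d v) = nH (c v).
  have := inv v; case: ifP => [_ [[_ _ _ [_ pv dv]] _]|_ dv]; last by rewrite step_halted.
  by rewrite step_active // (node_recv_mid _ _ pv ltp).
split => //; first by split=> [v h|h /mark2[v hv]]; [rewrite nH_step; apply: mark1 | exists v; rewrite nH_step].
move=> v; have := gather_informed inv (v := v); have := inv v.
case: ifP => [av [[idv nEv nUv [phv pv dv]] _] /(_ isT) inf|_ dv _]; last by rewrite step_halted.
rewrite /awake step_active // (node_recv_mid _ _ pv ltp) /=; split; first by split.
exact: inf.
Qed.

Lemma phase_start_step i U H c (d : draws c) : phase_start i U H c ->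
  in_phase i U H (draw_fun d) 1 (step d).
Proof.
move=> [sU sH mark inv]; apply: step_mid => // w; have := inv w.
case: ifP => // aw [idw nEw nUw [phw pw dw]]; split; first by split.
rewrite /known pw /= idw nEw nUw -draw_funE; split=> [f fb|z /= <- //].
by exists (vid w).
Qed.

Lemma in_phase_step i U H r p c (d : draws c) : 0 < p -> p.+1 < period ->
  in_phase i U H r p c -> in_phase i U H r p.+1 (step d).
Proof.
move=> p0 ltp [sU sH mark inv]; apply: step_mid => // w; have := inv w.
case: ifP => // aw [awk inf]; split => //.
by move: awk => [_ _ _ [_ pw _]]; rewrite /known pw gtn_eqF.
Qed.

(** Active vertices decide as in the global phase, by [added_exact], [remain_at] and
    [remain_concerns]; terminated ones concern no uncovered edge and have nothing to add. *)
Lemma in_phase_end i U H r p c (d : draws c) : 0 < p -> p.+1 = period ->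
  in_phase i U H r p c ->
  phase_start i.+1 (remain E U r) (H `|` additions E U r) (step d).
Proof.
move=> p0 ltp [sU sH [mark1 mark2] inv].
have inv' w : if active i U (vid w)
             then awake i U p c w /\
                  informed (active i U) (base U r) p (vid w) (known (c w) (d w))
             else ndone (c w).
  have := inv w; case: ifP => // aw [awk inf]; split => //.
  by move: awk => [_ _ _ [_ pw _]]; rewrite /known pw gtn_eqF.
have stepE v : active i U (vid v) -> exists2 F,
    informed (active i U) (base U r) period (vid v) F & step d v = finish (c v) F.
  move=> av; exists (gather (c v) (d v) (inbox d v)).
    by rewrite -ltp; apply: gather_informed.
  have := inv v; rewrite av => -[[_ _ _ [_ pv dv]] _].
  by rewrite step_active // (node_recv_end _ _ pv ltp).
have nH_step v : active i U (vid v) -> nH (step d v) = nH (c v) `|` added E U r (vid v).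
  move=> av; have [F inf ->] := stepE v av.
  have := inv v; rewrite av => -[[idv _ _ _] _].
  by rewrite /= idv (added_exact sU inf).
have dead v : active i U (vid v) = false -> step d v = c v.
  by move=> av; have := inv v; rewrite av => dv; apply: step_halted.
have addP h v : h \in added E U r (vid v) -> h \in additions E U r.
  rewrite in_added in_fsetU in_sep => /orP[/andP[vc hv]|/and3P[hU _ ->]]; last first.
    by rewrite hU orbT.
  apply/orP; left; apply/bigfcupP; exists (vid v) => //; rewrite vc andbT.
  have /andP[/andP[l0 _] _] := vc; have /fset0Pn[e /scov_spans/spans_centres] := scov_neq0 l0.
  by [].
have addE h : h \in additions E U r -> exists v, h \in added E U r (vid v).
  rewrite in_fsetU in_sep => /orP[/bigfcupP[z /andP[_ zc] hz]|/andP[hU sa]].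
    have [v vz] := id_touches (fsubsetP (core_subE _ _ _ _) _ hz) (star_touches hz).
    by exists v; rewrite in_added vz zc hz.
  have [v ve] : exists v : vertex G, vid v = h.1.
    by apply: (id_touches (fsubsetP sU _ hU)); rewrite /touches eqxx.
  by exists v; rewrite in_added hU ve eqxx sa orbT.
have add_active h v : h \in added E U r (vid v) -> active i U (vid v).
  by move=> /added_concerns cv; rewrite /active cv orbT.
split.
- exact: fsubset_trans (remain_sub _ _ _) sU.
- apply/fsubsetP => h; rewrite in_fsetU => /orP[/(fsubsetP sH) //|].
  rewrite in_fsetU in_sep => /orP[/bigfcupP[z _ hz]|/andP[/(fsubsetP sU)//]].
  exact: fsubsetP (core_subE _ _ _ _) _ hz.
- split=> [v h|h].
    case: (boolP (active i U (vid v))) => av; last first.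
      by rewrite dead ?(negPf av) // => /mark1[hH ht]; rewrite in_fsetU hH.
    rewrite nH_step // in_fsetU in_fsetU => /orP[/mark1[-> ht] //|hv].
    by rewrite (addP _ _ hv) orbT; split=> //; apply: added_touches hv.
  rewrite in_fsetU => /orP[/mark2[v hv]|/addE[v hv]]; exists v.
    case: (boolP (active i U (vid v))) => av; last by rewrite dead ?(negPf av).
    by rewrite nH_step // in_fsetU hv.
  by rewrite nH_step ?(add_active h) // in_fsetU hv orbT.
- move=> v; rewrite {1}/active /=.
  case: (boolP (active i U (vid v))) => av; last first.
    have -> : concerns E (remain E U r) (vid v) = false.
      apply: contraNF av => /(concerns_sub (remain_sub _ _ _)) cv.
      by rewrite /active cv orbT.
    by rewrite dead ?(negPf av) //; have := inv v; rewrite (negPf av).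
  have [F inf eqs] := stepE v av.
  have := inv v; rewrite av => -[[idv nEv nUv [phv pv dv]] _].
  have dn : ndone (step d v) = ~~ concerns E (remain E U r) (vid v).
    by rewrite eqs -(remain_concerns sU inf) -idv.
  case: ifP => cv; last by rewrite dn cv.
  split; [by rewrite eqs | by rewrite eqs | by rewrite eqs -(remain_at sU inf) -idv |].
  by split; [rewrite eqs /= phv | rewrite eqs | rewrite dn cv].
Qed.

Lemma all_haltedE i H c : phase_start i.+1 fset0 H c -> all_halted c.
Proof.
move=> [_ _ _ inv]; apply/forallP => v; rewrite haltedE; exact: (inv v).
Qed.

End Simulation.

(** * Termination probability *)

Section Draws.
Local Open Scope ring_scope.
Variables (R : realType) (I : finType) (n : I -> nat).

Local Notation Om := {dffun forall x : I, 'I_(n x).+1}.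

Lemma card_draws_gt0 : (0 < #|{: Om}|)%N.
Proof. by apply/card_gt0P; exists [ffun x => ord0]. Qed.

(** Independence of the draws: outcomes satisfying coordinatewise conditions form a product set. *)
Lemma Ex_family (P : forall x, pred 'I_(n x).+1) :
  Ex (fun d : Om => [forall x, P x (d x)]%:R) = \prod_x (#|P x|%:R / (n x).+1%:R) :> R.
Proof.
rewrite /Ex -natr_sum.
have -> : (\sum_(d : Om) [forall x, P x (d x)])%N = \prod_x #|P x|.
  rewrite -big_mkcond /= sum1_card.
  transitivity #|(family P : simpl_pred Om)|; first by apply: eq_card => d; apply/forallP/familyP.
  by rewrite card_family foldrE big_image.
have -> : #|{: Om}| = (\prod_x (n x).+1)%N.
  by rewrite card_dep_ffun foldrE big_image; apply: eq_bigr => x _; rewrite card_ord.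
by rewrite !natr_prod prodf_div.
Qed.

Lemma card_ord_lt m th : (th <= m.+1)%N -> #|[pred k : 'I_m.+1 | (k < th)%N]| = th.
Proof.
move=> le; rewrite -sum1_card -(big_mkord (fun k => (k < th)%N) (fun=> 1%N)) /=.
by rewrite -(big_nat_widen _ _ _ predT) // sum_nat_const_nat subn0 muln1.
Qed.

Lemma Ex_draw1 u B th : (n u).+1 = B -> (th <= B)%N ->
  Ex (fun d : Om => (d u < th)%N%:R) = th%:R / B%:R :> R.
Proof.
move=> <- le.
pose P x : pred 'I_(n x).+1 := fun k => (x == u) ==> (k < th)%N.
have -> : Ex (fun d : Om => (d u < th)%N%:R) = Ex (fun d : Om => [forall x, P x (d x)]%:R) :> R.
  congr (_ / _); apply: eq_bigr => d _; congr (nat_of_bool _)%:R.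
  apply/idP/forallP => [lt x|/(_ u)]; last by rewrite /P eqxx.
  by apply/implyP => /eqP ->.
rewrite Ex_family (bigD1 u) //= big1 ?mulr1 => [|x nxu].
  rewrite -{1}(card_ord_lt le); congr (_%:R / _); apply: eq_card => k.
  by rewrite !inE /P unfold_in eqxx.
rewrite (_ : #|P x| = (n x).+1) ?divff ?pnatr_eq0 //.
rewrite -[RHS]card_ord; apply: eq_card => k.
by rewrite !inE /P unfold_in (negPf nxu).
Qed.

Lemma Ex_draw2 u v B th : u != v -> (n u).+1 = B -> (n v).+1 = B -> (th <= B)%N ->
  Ex (fun d : Om => ((d u < th) && (d v < th))%N%:R) = (th%:R / B%:R) ^+ 2 :> R.
Proof.
move=> nuv nu nv le.
pose P x : pred 'I_(n x).+1 := fun k => (x \in pred2 u v) ==> (k < th)%N.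
have -> : Ex (fun d : Om => ((d u < th) && (d v < th))%N%:R) =
    Ex (fun d : Om => [forall x, P x (d x)]%:R) :> R.
  congr (_ / _); apply: eq_bigr => d _; congr (nat_of_bool _)%:R.
  apply/andP/forallP => [[ltu ltv] x|all_P].
    by apply/implyP => /orP[]/eqP ->.
  by have := all_P u; have := all_P v; rewrite /P !inE !eqxx orbT.
have factor x : x \in pred2 u v -> (n x).+1 = B -> #|P x|%:R / (n x).+1%:R = th%:R / B%:R :> R.
  move=> xuv nx; rewrite -nx; congr (_%:R / _); have le' := le; rewrite -nx in le'.
  rewrite -(card_ord_lt le'); apply: eq_card => k.
  by rewrite !inE /P unfold_in xuv.
rewrite Ex_family (bigD1 u) //= (bigD1 v) /=; last by rewrite eq_sym.
rewrite !factor ?inE ?eqxx ?orbT // big1 ?mulr1 => [|x /andP[nxu nxv]].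
  by rewrite expr2.
rewrite (_ : #|P x| = (n x).+1) ?divff ?pnatr_eq0 //.
rewrite -[RHS]card_ord; apply: eq_card => k.
by rewrite !inE /P unfold_in !inE (negPf nxu) (negPf nxv).
Qed.

End Draws.

Section Termination.
Local Open Scope ring_scope.
Variables (R : realType) (G : network).
Implicit Types (c : config spanner_algorithm G) (v w : vertex G).

Local Notation E := (id_edges G).

Lemma prob_afterS (Q : pred (config spanner_algorithm G)) t c :
  prob_after R Q t.+1 c = Ex (fun d : draws c => prob_after R Q t (step d)).
Proof. by []. Qed.

(** After its first round the outcome of a phase is fixed whatever is drawn later, so a bound valid
    at the next phase start is merely averaged. *)
Lemma prob_in_phase (Q : pred (config spanner_algorithm G)) i U H r b t k p c :
  (0 < p)%N -> (p + k = period)%N -> in_phase i U H r p c ->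
  (forall c', phase_start i.+1 (remain E U r) (H `|` additions E U r) c' ->
    b <= prob_after R Q t c') ->
  (0 < k)%N -> b <= prob_after R Q (k + t) c.
Proof.
move=> p0 pk inph bnd; elim: k p c p0 pk inph => // k IH p c p0 pk inph _.
rewrite addSn prob_afterS; apply: (@le_trans _ _ (Ex (fun _ : draws c => b))).
  by rewrite Ex_cst // card_draws_gt0.
apply: le_Ex => d.
case: k => [|k] in IH pk *.
  by apply: bnd; apply: in_phase_end inph => //; rewrite -pk addn1.
apply: (IH p.+1) => //; first by rewrite -pk addSnnS.
by apply: in_phase_step inph => //; rewrite -pk; lia.
Qed.

Lemma prob_phase (Q : pred (config spanner_algorithm G)) i U H t c
    (g : {fset edge} -> R) : phase_start i U H c ->
  (forall r H' c', phase_start i.+1 (remain E U r) H' c' ->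
    g (remain E U r) <= prob_after R Q t c') ->
  Ex (fun d : draws c => g (remain E U (draw_fun d))) <= prob_after R Q (period + t) c.
Proof.
move=> st bnd; rewrite -[period]/(6.+1) addSn prob_afterS; apply: le_Ex => d.
by apply: (prob_in_phase (p := 1)) (phase_start_step d st) _ _ => // c' /bnd.
Qed.

Lemma prob_after_ge0 (Q : pred (config spanner_algorithm G)) t c : 0 <= prob_after R Q t c.
Proof.
elim: t c => [|t IH] c; first by rewrite /= ler0n.
by rewrite prob_afterS /Ex divr_ge0 ?ler0n // sumr_ge0.
Qed.

Lemma prob_last i U H c (K : nat) : phase_start i U H c ->
  (forall k, (K <= k)%N -> phi E U k = 0%N) -> psi E K U = 0%N ->
  1 <= prob_after R (@all_halted spanner_algorithm G) period c.
Proof.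
move=> st big0 psi0.
pose g U' : R := (U' == fset0 :> {fset edge})%:R.
have -> : 1 = Ex (fun d : draws c => g (remain E U (draw_fun d))) :> R.
  rewrite -[LHS](Ex_cst 1 (card_draws_gt0 (fun v => coins (c v)))).
  by congr (_ / _); apply: eq_bigr => d _; rewrite /g (psi0_remain _ big0 psi0) eqxx.
rewrite -[period]addn0; apply: (prob_phase st) => r H' c'; rewrite /g.
case: eqP => [->|_] st'; last exact: ler0n.
by rewrite /= (all_haltedE st').
Qed.

Variable K : nat.
Hypothesis K_big : forall U k, U `<=` E -> (K <= k)%N -> phi E U k = 0%N.

Lemma Ex_psi_draws i U H c : phase_start i U H c ->
  (5 * #|` centres E| <= (2 ^ i).+1)%N ->
  Ex (fun d : draws c => (psi E K (remain E U (draw_fun d)))%:R) <=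
    (1 - 1 / 80) * (psi E K U)%:R :> R.
Proof.
move=> [sU _ _ inv] big_range.
(* Centres of uncovered edges are active, so all of them draw from a range of the same size 2^i +
   1. *)
have coinsE v z : vid v = z -> centre E U z -> (coins (c v)).+1 = (2 ^ i).+1%N.
  move=> vz /hasP[e eU sp]; have := inv v; rewrite vz /active /concerns.
  have -> : has (fun e => touches z e || spans E z e) U.
    by apply/hasP; exists e; rewrite // sp orbT.
  by rewrite orbT => -[_ _ _ [ph ps _]]; rewrite /= ps ph.
have vertexE z : centre E U z -> exists v : vertex G, vid v = z.
  by move=> /hasP[e _]; apply: id_spans.
apply: (Ex_psi (B := (2 ^ i).+1%N)) => //; first exact: card_draws_gt0.
- move=> z th cz le; have [v vz] := vertexE z cz.
  apply: etrans (Ex_draw1 R (coinsE v z vz cz) le); congr (_ / _).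
  by apply: eq_bigr => d _; rewrite -vz draw_funE.
- move=> y z th cy cz nyz le; have [u uy] := vertexE y cy; have [v vz] := vertexE z cz.
  have nuv : u != v by apply: contra nyz => /eqP uv; rewrite -uy -vz uv.
  apply: etrans (Ex_draw2 R nuv (coinsE u y uy cy) (coinsE v z vz cz) le).
  by congr (_ / _); apply: eq_bigr => d _; rewrite -uy -vz !draw_funE.
- by move=> k; apply: K_big.
Qed.

(** Markov's inequality by induction on phases: [psi] is an integer, so the base case is trivial
    unless it vanishes, and then the one extra phase finishes. *)
Lemma prob_ge T i U H c : phase_start i U H c ->
  (5 * #|` centres E| <= (2 ^ i).+1)%N ->
  1 - (psi E K U)%:R * (1 - 1 / 80) ^+ T <=
    prob_after R (@all_halted spanner_algorithm G) (period * T.+1) c.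
Proof.
elim: T i U H c => [|T IH] i U H c st big_range.
  rewrite expr0 mulr1 muln1; have [p0|p0] := posnP (psi E K U).
    have [sU _ _ _] := st.
    by rewrite p0 subr0; apply: (prob_last st _ p0) => k; apply: K_big.
  apply: le_trans (prob_after_ge0 _ _ _).
  by rewrite subr_le0 ler1n.
rewrite mulnS.
pose g U' : R := 1 - (psi E K U')%:R * (1 - 1 / 80) ^+ T.
apply: (@le_trans _ _ (Ex (fun d : draws c => g (remain E U (draw_fun d))))).
  have -> : Ex (fun d : draws c => g (remain E U (draw_fun d))) =
      1 - (1 - 1 / 80) ^+ T * Ex (fun d : draws c => (psi E K (remain E U (draw_fun d)))%:R).
    rewrite -ExZ -ExN -[X in X + _](Ex_cst 1 (card_draws_gt0 (fun v => coins (c v)))) -ExD.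
    by congr (_ / _); apply: eq_bigr => d _; rewrite /g mulrC.
  rewrite lerD2l lerN2 exprSr [leRHS]mulrCA.
  rewrite ler_wpM2l ?exprn_ge0 //; first lra.
  by rewrite [leRHS]mulrC; apply: Ex_psi_draws st big_range.
apply: (prob_phase st) => r H' c' st'; apply: IH st' _.
by apply: leq_trans big_range _; rewrite ltnS leq_exp2l.
Qed.

(** During the first [j] phases the range of the draws grows; nothing is asked of them but that
    [psi] does not increase. *)
Lemma prob_wait j T i U H c : phase_start i U H c ->
  (5 * #|` centres E| <= (2 ^ (i + j)).+1)%N ->
  1 - (psi E K U)%:R * (1 - 1 / 80) ^+ T <=
    prob_after R (@all_halted spanner_algorithm G) (period * (j + T.+1)) c.
Proof.
elim: j i U H c => [|j IH] i U H c st big_range.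
  by apply: prob_ge st _; rewrite addn0 in big_range.
rewrite addSn mulnS; set b := 1 - _.
apply: (@le_trans _ _ (Ex (fun _ : draws c => b))).
  by rewrite Ex_cst // card_draws_gt0.
apply: (prob_phase (g := fun=> b) st) => r H' c' st'.
apply: le_trans (IH _ _ _ _ st' _); last by rewrite addSnnS.
rewrite lerD2l lerN2 ler_wpM2r ?exprn_ge0 ?ler_nat ?psi_mono ?remain_sub //; lra.
Qed.

End Termination.

(** * Correctness of all runs *)

Section Runs.
Variable G : network.
Implicit Types (u v w : vertex G).

Local Notation E := (id_edges G).

Definition id_set (A : {set vertex G * vertex G}) : {fset edge} :=
  [fset (vid e.1, vid e.2) | e in A].

Lemma card_id_set A : #|` id_set A| = #|A|.
Proof.
rewrite card_imfset ?cardE //= => -[u v] [u' v'] /= [/vid_inj -> /vid_inj ->].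
by [].
Qed.

Lemma mem_id_set A u v : ((vid u, vid v) \in id_set A) = ((u, v) \in A).
Proof.
apply/imfsetP/idP => [[[u' v'] /= h [/vid_inj -> /vid_inj ->]] //|h].
by exists (u, v).
Qed.

Lemma id_setP (A : {set vertex G * vertex G}) e :
  reflect (exists u v, (u, v) \in A /\ e = (vid u, vid v)) (e \in id_set A).
Proof.
apply: (iffP (imfsetP _ _ _ _)) => [[[u v] /= h ->]|[u [v [h ->]]]]; first by exists u, v.
by exists (u, v).
Qed.

Lemma card_id_edges : #|` E| = nb_edges G.
Proof. exact: card_id_set. Qed.

Lemma id_spanP (A : {set vertex G * vertex G}) (w : nat) u v :
  spans (id_set A) w (vid u, vid v) ->
  exists2 x, w = vid x & (u, x) \in A /\ (x, v) \in A.
Proof.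
move=> /andP[/= /id_setP[u' [x [h1 [/vid_inj eu wx]]]]].
by rewrite wx mem_id_set => h2; exists x => //; split=> //; rewrite eu.
Qed.

Lemma directed_2spannerP (A : {set vertex G * vertex G}) : directed_2spanner A <->
  id_set A `<=` E /\
  forall e, e \in E -> e \in id_set A \/ exists w : nat, spans (id_set A) w e.
Proof.
split=> [[sA spA]|[sA spA]].
  split.
    apply/fsubsetP => e /id_setP[u [v [h ->]]]; rewrite mem_id_edges.
    exact: (subsetP sA).
  move=> e /id_edgesP[u [v [h ->]]]; have [p [pp lastp sz]] := spA u v h.
  case: p pp lastp sz => [|x [|y [|z p]]] //=.
  (* An empty path would make the edge a loop. *)
  - by move=> _ uv; move: h; rewrite uv (negPf (edges_loopless v)).
  - by rewrite andbT => ux <- _; left; rewrite mem_id_set.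
  - rewrite andbT => /andP[ux xy] <- _; right; exists (vid x).
    by rewrite /spans /= !mem_id_set ux.
split; first by apply/subsetP => -[u v] h; rewrite -mem_id_edges (fsubsetP sA) // mem_id_set.
move=> u v; rewrite -mem_id_edges => /spA[|[w /id_spanP[x _ [ux xv]]]].
  by rewrite mem_id_set => uv; exists [:: v]; rewrite /= uv.
by exists [:: x; v]; rewrite /= ux xv.
Qed.

(* Every vertex touches an edge of the graph, hence of any 2-spanner. *)
Lemma nb_vertices_spanner (A : {set vertex G * vertex G}) :
  directed_2spanner A -> 0 < nb_edges G -> nb_vertices G <= 2 * #|A|.
Proof.
move=> /directed_2spannerP[sA spA] /card_gt0P[[a b] ab].
have touch u : exists2 e, e \in E & touches (vid u) e.
  have [x nxu] : exists x, x != u.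
    have [eau|nau] := eqVneq a u; last by exists a.
    exists b; apply: contraTneq ab => ->; rewrite eau; exact: edges_loopless.
  have /connectP[p] := edges_connected u x.
  case: p => [_ xu|y p /= /andP[/orP[]h _] _].
  - by rewrite xu eqxx in nxu.
  - by exists (vid u, vid y); rewrite ?mem_id_edges // /touches /= eqxx.
  - by exists (vid y, vid u); rewrite ?mem_id_edges // /touches /= eqxx orbT.
have touchA u : has (touches (vid u)) (id_set A).
  have [e eE te] := touch u; have [eA|[w /andP[h1 h2]]] := spA e eE.
    by apply/hasP; exists e.
  case/orP: te => te; apply/hasP.
    by exists (e.1, w) => //; rewrite /touches te.
  by exists (w, e.2) => //; rewrite /touches /= te orbT.
rewrite -(card_id_set A) /nb_vertices -sum1_card size_sum_fset big_distrr /=.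
apply: (@leq_trans (\sum_(u : vertex G) \sum_(h <- id_set A) touches (vid u) h)).
  apply: leq_sum => u _; rewrite -card_sum_fset cardfs_gt0; apply/fset0Pn.
  by have /hasP[h hA th] := touchA u; exists h; rewrite in_sep hA.
rewrite exchange_big /= leq_sum // => h _.
have one z : \sum_(u : vertex G) (z == vid u) <= 1.
  rewrite -big_mkcond /= sum1_card; apply/card_le1P => u.
  by rewrite unfold_in => /eqP zu v; rewrite unfold_in zu; apply/eqP/eqP => [/vid_inj ->|->].
apply: leq_trans (leq_add (one h.1) (one h.2)).
by rewrite -big_split /= leq_sum // => u _; rewrite /touches; case: (_ == _); case: (_ == _).
Qed.

Variable run : nat -> config spanner_algorithm G.
Hypothesis runP : is_run run.

Lemma run_in_phase i U H r t k p : 0 < p -> p + k = period -> 0 < k ->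
  in_phase i U H r p (run t) ->
  phase_start i.+1 (remain E U r) (H `|` additions E U r) (run (t + k)).
Proof.
elim: k p t => // k IH p t p0 pk _ inph; have [d runS] := (proj2 runP) t.
case: k => [|k] in IH pk *.
  by rewrite addn1 runS; apply: in_phase_end inph => //; rewrite -pk addn1.
rewrite -addSnnS; apply: (IH p.+1) => //; first by rewrite -pk addSnnS.
by rewrite runS; apply: in_phase_step inph => //; rewrite -pk; lia.
Qed.

Lemma run_phase i U H t : phase_start i U H (run t) -> exists r,
  phase_start i.+1 (remain E U r) (H `|` additions E U r) (run (t + period)).
Proof.
move=> st; have [d runS] := (proj2 runP) t; exists (draw_fun d).
rewrite -[period]/(1 + 6) addnA addn1.
by apply: (run_in_phase (p := 1)) => //; rewrite runS; apply: phase_start_step.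
Qed.

(** By [remain_lt] each phase covers an edge, so every run ends; [P] is an invariant of phases. *)
Lemma run_ends (P : {fset edge} -> {fset edge} -> Prop) :
  P E fset0 ->
  (forall U H r, U `<=` E -> P U H -> P (remain E U r) (H `|` additions E U r)) ->
  exists t i H, phase_start i.+1 fset0 H (run t) /\ P fset0 H.
Proof.
move=> P0 PS; have st0 : phase_start 0 E fset0 (run 0).
  by rewrite (proj1 runP); apply: phase_start0.
suff ends n : forall i (U H : {fset edge}) t, #|` U| <= n -> phase_start i U H (run t) -> P U H ->
    exists t i H, phase_start i.+1 fset0 H (run t) /\ P fset0 H.
  exact: ends (leqnn _) st0 P0.
elim: n => [|n IH] i U H t leU st PUH; have [r st'] := run_phase st;
    have [sU _ _ _] := st; have PUH' := PS U H r sU PUH.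
  (* One phase is run even with nothing left to cover, so that the final phase index is a successor
     and all vertices have terminated. *)
  have U0 : remain E U r = fset0.
    apply/eqP; rewrite -fsubset0; have := remain_sub E U r.
    by move: leU; rewrite leqn0 cardfs_eq0 => /eqP ->.
  by rewrite U0 in st' PUH'; exists (t + period), i, (H `|` additions E U r).
have [U0|U0] := eqVneq U fset0; first by apply: IH st PUH; rewrite U0 cardfs0.
by apply: IH st' PUH'; rewrite -ltnS; apply: leq_trans (remain_lt _ _ U0) leU.
Qed.

Lemma mem_output_edges i H t u v : phase_start i.+1 fset0 H (run t) ->
  ((u, v) \in output_edges (run t)) = ((vid u, vid v) \in H).
Proof.
move=> st; have := all_haltedE st => /forallP done_t; have [_ sH [mark1 mark2] _] := st.
apply/bigcupP/idP => [[x _]|hH].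
  rewrite inE /= => /andP[_]; case: (ndone _) => //.
  by move=> /mark1[].
have [x hx] := mark2 _ hH; exists x => //.
have [_ tx] := mark1 _ _ hx; have hE := fsubsetP sH _ hH.
rewrite !inE /= -mem_id_edges hE /=; apply/andP; split.
  by case/orP: tx => /eqP/vid_inj ->; rewrite eqxx ?orbT.
by have := done_t x; rewrite haltedE => ->.
Qed.

Lemma id_output i H t : phase_start i.+1 fset0 H (run t) ->
  id_set (output_edges (run t)) = H.
Proof.
move=> st; have [_ sH _ _] := st; apply/fsetP => e; apply/id_setP/idP.
  by move=> [u [v [h ->]]]; rewrite -(mem_output_edges _ _ st).
move=> hH; have /id_edgesP[u [v [_ eE]]] := fsubsetP sH _ hH.
by exists u, v; split=> //; rewrite (mem_output_edges _ _ st) -eE.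
Qed.

Definition spanned (U H : {fset edge}) : Prop :=
  forall e, e \in E -> [\/ e \in U, e \in H | exists z : nat, spans H z e].

Lemma spanned_step (U H : {fset edge}) r : U `<=` E -> spanned U H ->
  spanned (remain E U r) (H `|` additions E U r).
Proof.
move=> sU sp e eE; case: (sp e eE) => [eU|eH|[z sz]]; last first.
- by constructor 3; exists z; apply: spans_sub sz; apply: fsubsetUl.
- by constructor 2; rewrite in_fsetU eH.
case: (boolP (e \in remain E U r)) => [?|]; first by constructor 1.
rewrite in_remain eU negbK => /orP[sa|/coveredP[z zc ez]].
  by constructor 2; rewrite in_fsetU in_fsetU in_sep eU sa !orbT.
constructor 3; exists z; apply: (@spans_sub (star E U z)); last first.
  by move: ez; rewrite in_cov => /andP[].
apply: fsubset_trans (fsubsetUr _ _); apply: fsubset_trans (fsubsetUl _ _).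
apply: bigfcup_sup => //; exact: spans_centres (scov_spans ez).
Qed.

Lemma run_correct (R : realType) : exists t,
  [/\ all_halted (run t), directed_2spanner (output_edges (run t)) &
      forall A : {set vertex G * vertex G}, directed_2spanner A ->
        (#|output_edges (run t)|%:R <= 16 * debt R E (id_set A) E)%R].
Proof.
(* Amortized invariant, against all spanners [A] at once: the edges bought so far plus 16 times the
   remaining debt never exceed 16 times the initial debt. *)
pose P (U H : {fset edge}) := spanned U H /\ forall A : {set vertex G * vertex G}, directed_2spanner A ->
  (#|` H|%:R + 16 * debt R E (id_set A) U <= 16 * debt R E (id_set A) E)%R.
have [||t [i [H [st [spH costH]]]]] := @run_ends P.
- split=> [e eE|A _]; first by constructor 1.
  by rewrite cardfs0 add0r.
- move=> U H r sU [sp cost]; split; first exact: spanned_step.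
  move=> A spA; have [sA sA'] := (directed_2spannerP A).1 spA.
  have le1 := debt_step R sA sA' r sU; have le2 := cost A spA.
  have le3 : (#|` H `|` additions E U r|%:R <= #|` H|%:R + #|` additions E U r|%:R :> R)%R.
    by rewrite -natrD ler_nat (leq_card_fsetU _ _).1.
  by move: le1 le2 le3; rewrite mulrBr; lra.
exists t; split; first exact: all_haltedE st.
  apply/directed_2spannerP; rewrite (id_output st); have [_ sH _ _] := st.
  by split=> // e /spH[|eH|sp]; [rewrite in_fset0 | left | right].
move=> A spA; rewrite -card_id_set (id_output st).
apply: le_trans (costH A spA); rewrite lerDl mulr_ge0 //; exact: debt_ge0.
Qed.

End Runs.

(** * Explicit bounds *)

Section Sizes.
Variable G : network.
Local Notation E := (id_edges G).

Lemma id_loopless z : (z, z) \notin E.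
Proof.
apply/negP => /id_edgesP[u [v [h [zu]]]]; rewrite zu => /vid_inj uv.
by move: h; rewrite uv (negPf (edges_loopless v)).
Qed.

Lemma card_touches (v : vertex G) :
  #|` [fset e in E | touches (vid v) e]| = #|incident v|.
Proof.
rewrite -(card_id_set (incident v)); congr #|` _|; apply/fsetP => e.
rewrite in_sep; apply/andP/id_setP => [[/id_edgesP[x [y [h ->]]] t]|[x [y [h ->]]]].
  exists x, y; split=> //; rewrite inE h /=.
  by case/orP: t => /eqP/vid_inj ->; rewrite eqxx ?orbT.
move: h; rewrite inE mem_id_edges /= => /andP[-> /orP[]/eqP ->];
  by rewrite /touches /= eqxx ?orbT.
Qed.

Lemma touches_degree z : (exists v : vertex G, vid v = z) ->
  #|` [fset e in E | touches z e]| <= max_degree G.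
Proof. by case=> v <-; rewrite card_touches; apply: leq_bigmax. Qed.

(** All spanned edges counted at [h] share with [h] the endpoint other than [v], and [h] itself also
    touches that endpoint without being counted. Looplessness keeps the two positions of [h] on a
    path apart. *)
Lemma sdeg_lt_degree (U S : {fset edge}) v h : U `<=` E -> S `<=` E -> h \in S ->
  0 < sdeg U S v h -> sdeg U S v h < max_degree G.
Proof.
move=> /fsubsetP sU /fsubsetP sS hS /sdeg_gt0[e [eU sp eh]].
have bound x : (exists w : vertex G, vid w = x) -> touches x h ->
    (forall f, f \in U -> spans S v f -> h = (f.1, v) \/ h = (v, f.2) ->
      touches x f /\ f != h) -> sdeg U S v h < max_degree G.
  move=> ex th sub; apply: leq_trans (touches_degree ex).
  rewrite /sdeg; set D := [fset _ in _ | _].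
  have memD f : f \in D -> [/\ f \in U, spans S v f & h = (f.1, v) \/ h = (v, f.2)].
    rewrite in_sep in_cov => /andP[/andP[fU sf] /orP[]/eqP hf]; split=> //.
      by left.
    by right.
  have hD : h \notin D.
    by apply/negP => hD; have [hU hs hh] := memD _ hD; have [_] := sub _ hU hs hh; rewrite eqxx.
  have -> : (#|` D|).+1 = #|` h |` D| by rewrite cardfsU1 hD.
  apply: fsubset_leq_card; apply/fsubsetP => f; rewrite in_fset1U in_sep.
  move=> /orP[/eqP ->|/memD[fU fs fh]]; first by rewrite sS.
  by have [-> _] := sub _ fU fs fh; rewrite sU.
have hE := sS _ hS.
have noloop x : (x, x) \in E -> False by move=> h1; have := id_loopless x; rewrite h1.
case: eh => eh.
  apply: (bound e.1).
  - by apply: (id_touches (sU _ eU)); rewrite /touches eqxx.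
  - by rewrite eh /touches eqxx.
  move=> f fU /andP[_ /sS s2] fh; split.
    case: fh => fh; have := congr1 fst fh; rewrite eh /= => h1.
      by rewrite /touches h1 eqxx.
    by move: hE; rewrite eh h1 => /noloop.
  by apply/eqP => fE; move: s2; rewrite fE eh /= => /noloop.
apply: (bound e.2).
- by apply: (id_touches (sU _ eU)); rewrite /touches eqxx orbT.
- by rewrite eh /touches eqxx orbT.
move=> f fU /andP[/sS s1 _] fh; split.
  case: fh => fh; have := congr1 snd fh; rewrite eh /= => h2.
    by move: hE; rewrite eh h2 => /noloop.
  by rewrite /touches h2 eqxx orbT.
by apply/eqP => fE; move: s1; rewrite fE eh /= => /noloop.
Qed.

Lemma phi_degree U k : U `<=` E -> up_log 2 (max_degree G) <= k -> phi E U k = 0.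
Proof.
move=> sU lek; rewrite /phi big1 // => v _.
have -> : core E U k v = fset0.
  apply/eqP; apply: contraTT isT => /fset0Pn[h hc].
  have le1 := denseP _ _ _ _ (core_dense E U k v) _ hc.
  have lt := sdeg_lt_degree sU (core_subE _ _ _ _) hc (leq_trans (expn_gt0 2 k) le1).
  have := leq_ltn_trans le1 lt; rewrite ltnNge.
  by rewrite (leq_trans (up_logP _ (isT : 1 < 2))) // leq_exp2l.
apply/eqP; rewrite cardfs_eq0; apply/eqP/fsetP => e.
by rewrite in_cov /spans !in_fset0 /= andbF.
Qed.

Lemma card_centres : #|` centres E| <= nb_vertices G.
Proof.
have -> : nb_vertices G = #|` [fset vid v | v : vertex G]|.
  by rewrite card_imfset /= -?cardE //; apply: vid_inj.
apply: fsubset_leq_card; apply/fsubsetP => z /imfsetP[h hE ->].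
have [v <-] : exists v : vertex G, vid v = h.2.
  by apply: (id_touches hE); rewrite /touches eqxx orbT.
by apply/imfsetP; exists v.
Qed.

Lemma card_edges_sq : #|` E| <= nb_vertices G * nb_vertices G.
Proof. by rewrite card_id_edges /nb_vertices -card_prod; apply: max_card. Qed.

Lemma degree_gt1_vertices : 1 < max_degree G -> 1 < nb_vertices G.
Proof.
move=> d1; have : 0 < #|` E|.
  rewrite lt0n; apply: contraTneq d1 => E0; rewrite -leqNgt.
  apply/bigmax_leqP => v _; apply: leq_trans (leq0n 1); rewrite -card_touches.
  by rewrite -E0; apply: fsubset_leq_card; apply/fsubsetP => e; rewrite in_sep => /andP[].
rewrite cardfs_gt0 => /fset0Pn[e /id_edgesP[u [v [h _]]]].
have : u != v by apply: contraTneq h => ->; apply: edges_loopless.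
by move=> nuv; apply/card_gt1P; exists u, v.
Qed.

Lemma psi_bound K : 1 < nb_vertices G -> psi E K E <= (nb_vertices G ^ 4) ^ K.
Proof.
move=> n1; apply: leq_trans (ltnW (psi_lt K (fsubset_refl E))) _.
have M : (#|` centres E| * #|` E|).+1 <= nb_vertices G ^ 4.
  set n := nb_vertices G in n1 *.
  have le : #|` centres E| * #|` E| <= n * (n * n).
    by apply: leq_mul; [apply: card_centres | apply: card_edges_sq].
  have n3 : 0 < n * (n * n) by rewrite !muln_gt0; lia.
  apply: (@leq_trans (2 * (n * (n * n)))); first lia.
  by rewrite (_ : n ^ 4 = n * (n * (n * n))) ?leq_mul2r ?n1 ?orbT // !expnS expn0 muln1.
by case: K => // K; rewrite leq_exp2r.
Qed.

End Sizes.

(** * Estimates for logarithms and geometric decay *)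

Section Bounds.
Local Open Scope ring_scope.
Variable R : realType.

Lemma ln2_ge : 1 / 2 <= ln 2 :> R.
Proof. by have := @ln_succ R 1 isT; rewrite ln1 subr0 div1r. Qed.

Lemma up_log2_le n : (1 < n)%N -> (up_log 2 n)%:R <= 2 * ln n%:R + 1 :> R.
Proof.
move=> n1; have := up_log_gtn (isT : (1 < 2)%N) n1.
have : (0 < up_log 2 n)%N by rewrite up_log_gt0 n1.
case: (up_log 2 n) => //= k _ lt; rewrite -natr1 lerD2r.
have : ln ((2 ^ k)%N%:R) <= ln n%:R :> R.
  by rewrite ler_ln ?posrE ?ltr0n ?expn_gt0 // ?ler_nat ltnW // ltnW.
rewrite natrX lnXn // -[_ *+ k]mulr_natr => le.
have := le_trans (ler_wpM2r (ler0n R k) ln2_ge) le.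
by move: (ln n%:R) => x; lra.
Qed.

Lemma expR_decay (T : nat) : (1 - 1 / 80) ^+ T <= expR (- (T%:R / 80)) :> R.
Proof.
rewrite -[- (T%:R / 80)]mulrN expRM_natl.
rewrite lerXn2r ?nnegrE ?expR_ge0 //; first lra.
by apply: le_trans (expR_ge1Dx _); rewrite div1r.
Qed.

End Bounds.

(** * Final ratio and running time *)

Section Main.
Local Open Scope ring_scope.
Variable R : realType.

(** The constant is 176 = 16 * 11, from [run_correct] and [debt_init]; a graph without edges is
    treated apart, its output being empty. *)
Lemma approximation_ratio (G : network) (run : nat -> config spanner_algorithm G) :
  is_run run -> exists t : nat,
    [/\ all_halted (run t), directed_2spanner (output_edges (run t)) &
      forall H : {set vertex G * vertex G}, directed_2spanner H ->
        #|output_edges (run t)|%:R <=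
        176 * Num.max 1 (ln ((nb_edges G)%:R / (nb_vertices G)%:R)) * #|H|%:R :> R].
Proof.
move=> runP; have [t [done_t span_t cost_t]] := run_correct runP R.
exists t; split=> // H spH; have [m0|m0] := posnP (nb_edges G).
  have -> : #|output_edges (run t)| = 0%N.
    apply/eqP; rewrite -leqn0 -m0; apply: subset_leq_card.
    by have [] := span_t.
  by rewrite mulr_ge0 // mulr_ge0 // le_max ler01.
apply: le_trans (cost_t H spH) _; rewrite -card_id_set.
have [sH spH'] := (directed_2spannerP H).1 spH.
have nH := nb_vertices_spanner spH m0.
have n0 : (0 < nb_vertices G)%N.
  by have /card_gt0P[[u v] _] := m0; apply/card_gt0P; exists u.
rewrite -(card_id_edges G) in m0 *; rewrite -(card_id_set H) in nH.
have := debt_init R sH spH' m0 n0 nH.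
set M := Num.max _ _; set h := #|` _|%:R; move: (debt _ _ _ _) => b le.
by apply: le_trans (ler_wpM2l _ le) _ => //; rewrite -!mulrA mulrA; lra.
Qed.

(** With (1 - 1/80)^T <= e^(-T/80), the exponent 4 K ln n - T / 80 is at most - c ln n. *)
Lemma failure_bound (K T n : nat) (c : R) : (1 < n)%N ->
  80 * (4 * K%:R + c) * ln n%:R <= T%:R ->
  ((n ^ 4) ^ K)%N%:R * (1 - 1 / 80) ^+ T <= 1 / powR n%:R c.
Proof.
move=> n1 leT; have n0 : 0 < n%:R :> R by rewrite ltr0n ltnW.
have -> : 1 / powR n%:R c = expR (- (c * ln n%:R)) by rewrite div1r -powRN /powR gt_eqF // mulNr.
have -> : ((n ^ 4) ^ K)%N%:R = expR (4 * K%:R * ln n%:R) :> R.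
  by rewrite -expnM natrX -natrM expRM_natl lnK ?posrE.
apply: le_trans (ler_wpM2l (expR_ge0 _) (expR_decay _ T)) _.
rewrite -expRD ler_expR; move: leT; move: (ln n%:R) => x; lra.
Qed.

(** Both logarithms are at least 1/2, so ln n <= 2 M and K ln n <= 4 M. The constant 1297 is 15 for
    [j], 320 * 4 for the term in [K], and 2 for rounding [T] up and the extra phase. *)
Lemma round_bound (n D j K T : nat) (c : R) : 1 <= c -> (1 < n)%N -> (1 < D)%N ->
  j%:R <= 2 * ln (5 * n)%N%:R + 1 :> R -> K%:R <= 2 * ln D%:R + 1 :> R ->
  T%:R <= 80 * (4 * K%:R + c) * ln n%:R + 1 ->
  (period * (j + T.+1))%N%:R <=
    7 * (1297 + 160 * c) * Num.max 1 (ln n%:R * ln D%:R).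
Proof.
move=> c1 n1 D1 lej leK leT.
have ln_ge m : (1 < m)%N -> 1 / 2 <= ln m%:R :> R.
  by move=> m1; apply: le_trans (ln2_ge R) _; rewrite ler_ln ?posrE ?ltr0n ?ler_nat // ltnW.
have x1 := ln_ge _ n1; have y1 := ln_ge _ D1.
have ln5 : ln (5 * n)%N%:R <= 5 + ln n%:R :> R.
  rewrite natrM lnM ?posrE ?ltr0n ?(ltnW n1) // lerD2r.
  by apply: ltW; apply: ln_sublinear.
move: lej ln5 leK leT x1 y1; set M := Num.max _ _.
have M1 : 1 <= M by rewrite le_max lexx.
have Mxy : ln n%:R * ln D%:R <= M by rewrite le_max lexx orbT.
move: M1 Mxy; move: M => M; move: (ln n%:R) (ln D%:R) (ln (5 * n)%N%:R) => x y z M1 Mxy lej ln5 leK leT x1 y1.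
rewrite natrM natrD -natr1 -[period]/7%N.
have xM : x <= 2 * M by nra.
have Kx : K%:R * x <= 4 * M by nra.
have cx : c * x <= 2 * c * M by nra.
have TM : T%:R <= 1280 * M + 160 * c * M + 1.
  apply: le_trans leT _; rewrite lerD2r mulrDr mulrDl; nra.
nra.
Qed.

Lemma termination_time (c : R) : 1 <= c -> forall G : network, exists t : nat,
  t%:R <= 7 * (1297 + 160 * c) *
    Num.max 1 (ln (nb_vertices G)%:R * ln (max_degree G)%:R) /\
  1 - 1 / powR (nb_vertices G)%:R c <= prob_terminates spanner_algorithm G R t.
Proof.
move=> c1 G; set n := nb_vertices G; set D := max_degree G; set M := Num.max _ _.
have M1 : 1 <= M by rewrite le_max lexx.
have K_big := @phi_degree G; have st := phase_start0 G.
have p0 : 0 <= 1 / powR n%:R c by rewrite divr_ge0 ?powR_ge0.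
(* With degree at most 1 all cores are empty, and a single phase finishes with certainty. *)
have [D1|D1] := leqP D 1.
  exists period; split; first by rewrite -[period]/7%N; nra.
  have K0 : up_log 2 D = 0%N by apply/eqP; rewrite up_log_eq0 D1 orbT.
  apply: (@le_trans _ _ 1); first by lra.
  apply: (prob_last R (K := 0) st); last by rewrite /psi big_ord0.
  by move=> k _; apply: K_big; rewrite ?fsubset_refl // -/D K0.
have n1 : (1 < n)%N := degree_gt1_vertices D1.
set K := up_log 2 D.
set x : R := 80 * (4 * K%:R + c) * ln n%:R.
have x0 : 0 <= x.
  apply: mulr_ge0; last by rewrite ln_ge0 // ler1n ltnW.
  by apply: mulr_ge0 => //; apply: addr_ge0; [exact: mulr_ge0 | exact: le_trans ler01 c1].
have [T leT geT] : exists2 T : nat, x <= T%:R & T%:R <= x + 1.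
  have /andP[le lt] := truncn_itv x0; exists (Num.truncn x).+1; first exact: ltW.
  by rewrite -natr1 lerD2r.
exists (period * (up_log 2 (5 * n) + T.+1))%N; split.
  apply: (round_bound (K := K) c1 n1 D1 _ _ geT); last exact: up_log2_le.
  by apply: up_log2_le; rewrite -[1%N]muln1 ltn_mul.
(* After up_log 2 (5 n) phases the range of the draws reaches the 5 n required for the expected
   decrease of the potential. *)
have big_range : (5 * #|` centres (id_edges G)| <= (2 ^ (0 + up_log 2 (5 * n))).+1)%N.
  apply: leqW; apply: leq_trans (up_logP _ _) => //.
  by rewrite leq_mul2l card_centres.
apply: le_trans (prob_wait R K_big T st big_range).
rewrite lerD2l lerN2; apply: le_trans (failure_bound n1 leT).
rewrite ler_wpM2r ?exprn_ge0 ?ler_nat ?psi_bound //; lra.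
Qed.

End Main.

Local Close Scope fset_scope.
Local Open Scope ring_scope.

Theorem theorem28 (R : realType) :
  exists (A : local_algorithm) (K : R),
    (forall (G : network) (run : nat -> config A G), is_run run ->
       exists t : nat,
         [/\ all_halted (run t),
             directed_2spanner (output_edges (run t))
           & forall H : {set vertex G * vertex G}, minimum_directed_2spanner H ->
               #|output_edges (run t)|%:R
               <= K * Num.max 1 (ln ((nb_edges G)%:R / (nb_vertices G)%:R))
                    * #|H|%:R]) /\
    (forall c : R, 1 <= c ->
       exists C : R, forall G : network,
         exists t : nat,
           t%:R <= C * Num.max 1 (ln (nb_vertices G)%:R * ln (max_degree G)%:R) /\
           1 - 1 / powR (nb_vertices G)%:R c <= prob_terminates A G R t).
Proof.
exists spanner_algorithm, 176; split=> [G run runP|c c1].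
  have [t [done_t span_t ratio]] := approximation_ratio R runP.
  by exists t; split=> // H [spH _]; apply: ratio.
by exists (7 * (1297 + 160 * c)); apply: termination_time.
Qed.
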